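(* Let $V$ be a commutative valuation domain with quotient field $F$ such that $J(V)$ is a principal ideal of $V$, let $K/F$ be a finite Galois extension with group $G$ which is tamely ramified and defectless, and suppose $V$ is indecomposed in $K$, i.e. the integral closure $S$ of $V$ in $K$ is a valuation ring. Let $f:G\times G\to S\setminus\{0\}$ be a normalized $2$-cocycle and $H=\{\sigma\in G: f(\sigma,\sigma^{-1})\in U(S)\}$. Then the following are equivalent: (1) $A_f$ is semihereditary; (2) $f(\sigma,\tau)\notin J(S)^2$ for every $\sigma,\tau\in G$; (3) $H$ is a normal subgroup of $G$ and $G/H$ is cyclic; further, either $H=G$, or there exists $\sigma\in G$ such that $G/H=\langle\sigma H\rangle$, the graph $\mathrm{Gr}(f)$ is the chain $H\le\sigma H\le\sigma^2H\le\cdots\le\sigma^{|G/H|-1}H$, and $J(A_f)=x_\sigma A_f$.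
   Context: $V$ has arbitrary Krull dimension. A normalized 2-cocycle satisfies $\sigma(f(\tau,\gamma))f(\sigma,\tau\gamma)=f(\sigma,\tau)f(\sigma\tau,\gamma)$ and $f(1,\sigma)=f(\sigma,1)=1$; its values need not be units. $A_f=\bigoplus_{\sigma\in G}Sx_\sigma$ is the free left $S$-module on symbols $x_\sigma$ with multiplication $(sx_\sigma)(tx_\tau)=s\,\sigma(t)f(\sigma,\tau)x_{\sigma\tau}$; it is a $V$-order in $(K/F,G,f)$. $J(R)$ is the Jacobson radical, $U(R)$ the unit group. $H$ is a subgroup of $G$. The graph $\mathrm{Gr}(f)$ is the partial order on the left coset space $G/H$ given by $\sigma H\le\tau H$ iff $f(\sigma,\sigma^{-1}\tau)\in U(S)$ (well defined). A ring is semihereditary if finitely generated one-sided ideals are projective. Tamely ramified and defectless: with $e=[\Gamma_S:\Gamma_V]$ the ramification index and $\overline S,\overline V$ residue fields, $[K:F]=e[\overline S:\overline V]$ (defectless, $S$ being the unique extension), $\mathrm{char}\,\overline V\nmid e$ and $\overline S/\overline V$ separable. *)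

(* Defs.v *)
From HB Require Import structures.
From mathcomp Require Import all_boot all_order all_algebra all_fingroup all_solvable all_field.
Set Implicit Arguments. Unset Strict Implicit. Unset Printing Implicit Defensive.
Import GRing.Theory.
Local Open Scope ring_scope.

Section ConcreteRing.
Variables (T : zmodType) (mul : T -> T -> T) (A : T -> Prop).

Definition left_ideal (I : T -> Prop) :=
  [/\ forall x, I x -> A x, I 0, (forall x y, I x -> I y -> I (x - y))
    & forall a x, A a -> I x -> I (mul a x)].

Definition right_ideal (I : T -> Prop) :=
  [/\ forall x, I x -> A x, I 0, (forall x y, I x -> I y -> I (x - y))
    & forall a x, A a -> I x -> I (mul x a)].

Definition maximal_left_ideal (M : T -> Prop) :=
  [/\ left_ideal M, (exists a, A a /\ ~ M a)
    & forall N, left_ideal N -> (forall x, M x -> N x) ->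
        (forall x, N x <-> M x) \/ (forall x, N x <-> A x)].

Definition jacobson (x : T) :=
  A x /\ forall M, maximal_left_ideal M -> M x.

Definition fg_left_ideal (I : T -> Prop) :=
  left_ideal I /\ exists n (g : 'I_n -> T), (forall i, I (g i)) /\
    forall x, I x <-> exists c : 'I_n -> T, (forall i, A (c i)) /\
                       x = \sum_(i < n) mul (c i) (g i).

Definition fg_right_ideal (I : T -> Prop) :=
  right_ideal I /\ exists n (g : 'I_n -> T), (forall i, I (g i)) /\
    forall x, I x <-> exists c : 'I_n -> T, (forall i, A (c i)) /\
                       x = \sum_(i < n) mul (g i) (c i).

(* A (finitely generated) left module I <= A is projective: it is a direct *)
(* summand (retract) of a free module A^n, via A-linear maps.              *)
Definition projective_left (I : T -> Prop) :=
  exists n (p : ('I_n -> T) -> T) (j : T -> ('I_n -> T)),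
  [/\ forall v, (forall i, A (v i)) -> I (p v),
      forall a v w, A a -> (forall i, A (v i)) -> (forall i, A (w i)) ->
        p (fun i => mul a (v i) + w i) = mul a (p v) + p w,
      forall x, I x -> forall i, A (j x i),
      forall a x y, A a -> I x -> I y ->
        j (mul a x + y) = (fun i => mul a (j x i) + j y i)
    & forall x, I x -> p (j x) = x].

Definition projective_right (I : T -> Prop) :=
  exists n (p : ('I_n -> T) -> T) (j : T -> ('I_n -> T)),
  [/\ forall v, (forall i, A (v i)) -> I (p v),
      forall a v w, A a -> (forall i, A (v i)) -> (forall i, A (w i)) ->
        p (fun i => mul (v i) a + w i) = mul (p v) a + p w,
      forall x, I x -> forall i, A (j x i),
      forall a x y, A a -> I x -> I y ->
        j (mul x a + y) = (fun i => mul (j x i) a + j y i)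
    & forall x, I x -> p (j x) = x].

Definition semihereditary :=
  (forall I, fg_left_ideal I -> projective_left I) /\
  (forall I, fg_right_ideal I -> projective_right I).

End ConcreteRing.

Section FieldSubrings.
Variable (K : fieldType).

Definition subring (A : {pred K}) :=
  [/\ 1 \in A, (forall x y, x \in A -> y \in A -> x - y \in A)
    & forall x y, x \in A -> y \in A -> x * y \in A].

Definition valuation_ring (A : {pred K}) :=
  subring A /\ forall x, x != 0 -> (x \in A) \/ (x^-1 \in A).

Definition radical (A : {pred K}) : K -> Prop := jacobson *%R (fun x => x \in A).

Definition unit_of (A : {pred K}) (x : K) : bool :=
  [&& x \in A, x != 0 & x^-1 \in A].

Definition radical_sq (A : {pred K}) (x : K) : Prop :=
  exists n (a b : 'I_n -> K),
    (forall i, radical A (a i) /\ radical A (b i)) /\ x = \sum_(i < n) a i * b i.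

Definition principal_ideal (A : {pred K}) (I : K -> Prop) :=
  exists2 p, p \in A & forall x, I x <-> exists2 v, v \in A & x = p * v.

End FieldSubrings.

Section Extension.
Variables (F : fieldType) (L : fieldExtType F).

Definition integral_over (V : {pred F}) (x : L) :=
  exists p : {poly F}, [/\ p \is monic, (forall i, p`_i \in V)
                         & root (map_poly (in_alg L) p) x].

(* ramification index e = [Gamma_S : Gamma_V], where Gamma_S = L^x / U(S) *)
(* and Gamma_V is the image of F^x: t_1..t_e represent the cosets.        *)
Definition ramification_index (S : {pred L}) (e : nat) :=
  exists t : 'I_e -> L, [/\ forall i, t i != 0,
    forall x, x != 0 -> exists i, exists2 a : F, a != 0 &
                          unit_of S (x / (t i * in_alg L a))
  & forall i j, (exists2 a : F, a != 0 & unit_of S (t i / (t j * in_alg L a))) ->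
                i = j].

(* residue degree [S/J(S) : V/J(V)] = n : s_1..s_n in S whose residues  *)
(* form a basis of S/J(S) over V/J(V).                                  *)
Definition residue_degree (V : {pred F}) (S : {pred L}) (n : nat) :=
  exists s : 'I_n -> L, [/\ forall i, s i \in S,
    forall v : 'I_n -> F, (forall i, v i \in V) ->
       radical S (\sum_(i < n) in_alg L (v i) * s i) -> forall i, radical V (v i)
  & forall x, x \in S -> exists v : 'I_n -> F, (forall i, v i \in V) /\
       radical S (x - \sum_(i < n) in_alg L (v i) * s i)].

(* the residue field extension S/J(S) over V/J(V) is separable: every    *)
(* residue class is a root of a polynomial over V/J(V) coprime with its  *)
(* derivative (the reductions mod J(V) of polynomials over V).           *)
Definition residue_separable (V : {pred F}) (S : {pred L}) :=
  forall x, x \in S -> exists p : {poly F}, [/\ p \is monic, (forall i, p`_i \in V),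
    radical S (map_poly (in_alg L) p).[x]
  & exists a b : {poly F}, [/\ forall i, a`_i \in V, forall i, b`_i \in V
      & forall i, radical V (a * p + b * p^`() - 1)`_i]].

Definition tame_defectless (V : {pred F}) (S : {pred L}) :=
  exists e n, [/\ ramification_index S e, residue_degree V S n,
                  \dim {:L} = (e * n)%N,
                  ~ radical V (e%:R : F)   (* char of V/J(V) does not divide e *)
                & residue_separable V S].

End Extension.

Section Crossed.
Variables (F : fieldType) (L : splittingFieldType F).

Local Notation gT := (gal_of {:L}).

(* composition sigma o tau (MathComp's group law is (x * y) a = y (x a)) *)
Definition gcomp (s t : gT) : gT := (t * s)%g.

Definition normalized_cocycle (G : {set gT}) (f : gT -> gT -> L) :=
  (forall s, s \in G -> f 1%g s = 1 /\ f s 1%g = 1) /\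
  forall s t u, s \in G -> t \in G -> u \in G ->
    s (f t u) * f s (gcomp t u) = f s t * f (gcomp s t) u.

(* the crossed product algebra: elements are coefficient families        *)
(* a = sum_sigma a(sigma) x_sigma                                         *)
Definition cp_mul (G : {set gT}) (f : gT -> gT -> L)
  (a b : {ffun gT -> L}) : {ffun gT -> L} :=
  [ffun r => \sum_(s in G) a s * s (b (gcomp (s^-1)%g r)) * f s (gcomp (s^-1)%g r)].

Definition xsym (s : gT) : {ffun gT -> L} := [ffun t => if t == s then 1 else 0].

Definition Af (G : {set gT}) (S : {pred L}) (a : {ffun gT -> L}) : Prop :=
  (forall s, s \in G -> a s \in S) /\ (forall s, s \notin G -> a s = 0).

Definition Hf (G : {set gT}) (S : {pred L}) (f : gT -> gT -> L) : {set gT} :=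
  [set s in G | unit_of S (f s (s^-1)%g)].

(* the relation of the graph Gr(f): sigma H <= tau H *)
Definition Gr_le (S : {pred L}) (f : gT -> gT -> L) (s t : gT) : bool :=
  unit_of S (f s (gcomp (s^-1)%g t)).

End Crossed.

(* Main.v *)
(* Write J for the nonunits of S and A = A_f. The trace of S to V is onto: a  *)
(* linear algebra argument over the residue fields shows that the inertia     *)
(* group has order e, a unit, and automorphisms that are distinct modulo      *)
(* inertia are independent modulo J. So each subgroup has an element of trace *)
(* one, and Maschke averaging over H is available.                            *)
(*   If f s t = a b with a, b in J, then A x_s + A a is not projective.       *)
(* Conversely, if f avoids J^2, then w(s, t) = [f s t in J] is an additive    *)
(* 2-cocycle with values in {0, 1}; phi(s) = sum_t w(s, t) splits |G| w, so   *)
(* phi / |G| is a homomorphism to Q / Z with kernel H, G / H is cyclic, and   *)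
(* an element s0 with minimal positive phi generates it and gives the chain.  *)
(* Then x_s0 A = A x_s0 is nilpotent modulo J A, and A / x_s0 A is the        *)
(* crossed product of H over S / J with unit cocycle, semisimple by Maschke;  *)
(* hence J(A) = x_s0 A.                                                       *)
(*   For a finitely generated left ideal with presentation A^n -> I and       *)
(* kernel Z, averaging gives an A-linear r : A^n -> Z which is the identity   *)
(* of Z modulo x_s0 Z; by Nakayama r is invertible on Z, so Z is a summand.   *)
(* Right ideals follow by passing to the opposite ring.                       *)

Require Import Defs.
From HB Require Import structures.
From mathcomp Require Import all_boot all_order all_algebra all_fingroup all_solvable all_field.
From mathcomp Require Import ring.
From mathcomp Require boolp classical_sets.
Set Implicit Arguments. Unset Strict Implicit. Unset Printing Implicit Defensive.
Import GRing.Theory.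
Local Open Scope ring_scope.

(** * Valuation rings *)

(** The pivot is condition (2), used in the form [nosq]: no value of f is a product of two nonunits
    of S. It agrees with avoiding J(S)^2 because a sum of products of nonunits in a valuation ring
    is again one such product ([radical_sqP]).

    (1) implies (2), [projective_nosq]: a factorization f s t = a b into nonunits yields a
    two-generated left ideal without a dual basis.

    (2) implies (3): counting nonunits in the cocycle identity gives an additive 2-cocycle w with
    values 0 and 1 ([weight_cocycle]). Its row sums phi satisfy phi s + phi t = |G| w(s, t) + phi(s
    o t) and 0 <= phi < |G|, and vanish exactly on H. Normality, cyclicity and the chain are
    arithmetic of phi; the generator s0 is a point where phi is positive and minimal. At such a
    point f takes only units and generators of J as values ([minimal_uniformizing]), so x_s0 A is
    described by coefficients alone ([radical_latticeP]), and it is the radical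
    ([jacobson_uniformizing]).

    (2) implies (1): the kernel of A^n -> I is a lattice cut out by a subspace, so it splits over S
    by Gaussian elimination. If H = G, averaging makes the splitting A-linear ([retraction_unit]).
    Otherwise averaging over H gives an A-linear map that is the identity of the kernel only modulo
    x_s0 ([radical_splitting]), and Nakayama corrects it ([retraction_uniformizing]). Right ideals
    are left ideals of the opposite crossed product.

    (3) implies (2), [chain_nosq]: by the chain, f(s, s^-1) is a unit or an associate of q = f(s0,
    s0^-1), and J(A) = x_s0 A makes q divide every nonunit; since f(s, t) divides f(s, s^-1), it
    cannot be a product of two nonunits.

    All averaging needs an element of trace one for a subgroup ([trace_one]). Tameness provides it
    once the inertia group is known to have order e ([card_inertia]), which is Artin's theorem for
    the residue fields, carried out with congruences modulo J. *)

Definition nonunit (K : fieldType) (S : {pred K}) (x : K) : bool :=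
  (x \in S) && ~~ unit_of S x.

Section Valuation.
Variables (K : fieldType) (S : {pred K}).
Hypothesis valS : valuation_ring S.
Implicit Types x y z : K.

Lemma val1 : 1 \in S. Proof. by case: valS => [[]]. Qed.
Lemma valB x y : x \in S -> y \in S -> x - y \in S.
Proof. by case: valS => [[_ h _] _]; apply: h. Qed.
Lemma valM x y : x \in S -> y \in S -> x * y \in S.
Proof. by case: valS => [[_ _ h] _]; apply: h. Qed.
Lemma val0 : 0 \in S. Proof. by rewrite -(subrr 1) valB ?val1. Qed.
Lemma valN x : x \in S -> - x \in S.
Proof. by move=> Sx; rewrite -sub0r valB ?val0. Qed.
Lemma valD x y : x \in S -> y \in S -> x + y \in S.
Proof. by move=> Sx Sy; rewrite -[y]opprK valB ?valN. Qed.
Lemma valX x n : x \in S -> x ^+ n \in S.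
Proof. by move=> Sx; elim: n => [|n IH]; rewrite ?val1 // exprS valM. Qed.
Lemma valMn x n : x \in S -> x *+ n \in S.
Proof. by move=> Sx; elim: n => [|n IH]; rewrite ?val0 // mulrS valD. Qed.
Lemma val_sum (I : Type) (r : seq I) (P : pred I) (F : I -> K) :
  (forall i, P i -> F i \in S) -> \sum_(i <- r | P i) F i \in S.
Proof. by move=> h; apply: (big_ind (fun x => x \in S)) => //; [exact: val0|exact: valD]. Qed.

Lemma valV x : x != 0 -> x \notin S -> x^-1 \in S.
Proof. by move=> x0 nx; case: valS => _ /(_ x x0)[]; rewrite ?(negPf nx). Qed.
Lemma val_div x y : x != 0 -> y != 0 -> (x / y \in S) \/ (y / x \in S).
Proof.
move=> x0 y0; case: valS => _ /(_ (x / y)); rewrite mulf_neq0 ?invr_eq0 //.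
by rewrite invf_div => /(_ isT).
Qed.

Lemma unit1 : unit_of S 1.
Proof. by rewrite /unit_of oner_neq0 invr1 val1. Qed.
Lemma unit_val x : unit_of S x -> x \in S. Proof. by case/and3P. Qed.
Lemma unit_neq0 x : unit_of S x -> x != 0. Proof. by case/and3P. Qed.
Lemma unitV x : unit_of S x^-1 = unit_of S x.
Proof. by rewrite /unit_of invr_eq0 invrK; case: (x \in S); case: (x^-1 \in S); rewrite ?andbF. Qed.
Lemma unit_valV x : unit_of S x -> x^-1 \in S. Proof. by case/and3P. Qed.
Lemma unitM x y : unit_of S x -> unit_of S y -> unit_of S (x * y).
Proof.
case/and3P=> a b c /and3P[a' b' c'].
by rewrite /unit_of invfM !valM ?mulf_neq0.
Qed.
Lemma unitMl x y : x \in S -> y \in S -> unit_of S (x * y) -> unit_of S x.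
Proof.
move=> Sx Sy /and3P[_]; rewrite mulf_eq0 negb_or => /andP[x0 y0] h.
have e : x^-1 = y * (x * y)^-1 by field; apply/andP.
by rewrite /unit_of Sx x0 e valM.
Qed.
Lemma unitMr x y : x \in S -> y \in S -> unit_of S (x * y) -> unit_of S y.
Proof. by move=> Sx Sy; rewrite mulrC; apply: unitMl. Qed.

Lemma nonunit_val x : nonunit S x -> x \in S. Proof. by case/andP. Qed.
Lemma nonunit_not_unit x : nonunit S x -> ~~ unit_of S x. Proof. by case/andP. Qed.
Lemma unit_nonunitF x : unit_of S x -> nonunit S x = false.
Proof. by rewrite /nonunit => ->; rewrite andbF. Qed.
Lemma nonunit_unitE x : x \in S -> ~~ nonunit S x = unit_of S x.
Proof. by rewrite /nonunit => ->; rewrite negbK. Qed.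
Lemma nonunit0 : nonunit S 0.
Proof. by rewrite /nonunit val0 /unit_of eqxx andbF. Qed.
Lemma nonunit1 : nonunit S 1 = false.
Proof. by rewrite unit_nonunitF ?unit1. Qed.
Lemma nonunitMl x y : x \in S -> nonunit S y -> nonunit S (x * y).
Proof.
move=> Sx /andP[Sy ny]; rewrite /nonunit valM //=.
by apply: contra ny => /(unitMr Sx Sy).
Qed.
Lemma nonunitMr x y : nonunit S x -> y \in S -> nonunit S (x * y).
Proof. by move=> jx Sy; rewrite mulrC nonunitMl. Qed.
Lemma nonunit_inv x : x \notin S -> nonunit S x^-1.
Proof.
move=> nx; have x0 : x != 0 by apply: contraNneq nx => ->; exact: val0.
by rewrite /nonunit valV //= unitV /unit_of (negPf nx).
Qed.
Lemma nonunit_unitMl x y : unit_of S x -> nonunit S (x * y) = nonunit S y.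
Proof.
move=> ux; apply/idP/idP => [h|]; last by apply: nonunitMl; apply: unit_val.
by rewrite -(mulKf (unit_neq0 ux) y) nonunitMl // unit_valV.
Qed.
Lemma nonunit_opp x : nonunit S x -> nonunit S (- x).
Proof. by move=> h; rewrite -mulN1r nonunitMl ?valN ?val1. Qed.
Lemma nonunitD x y : nonunit S x -> nonunit S y -> nonunit S (x + y).
Proof.
case: (eqVneq x 0) => [->|x0]; first by rewrite add0r.
case: (eqVneq y 0) => [->|y0]; first by rewrite addr0.
move=> jx jy; case: (val_div x0 y0) => h.
  have -> : x + y = (x / y + 1) * y by field.
  by rewrite nonunitMl // valD ?val1.
have -> : x + y = (1 + y / x) * x by field.
by rewrite nonunitMl // valD ?val1.
Qed.
Lemma nonunitB x y : nonunit S x -> nonunit S y -> nonunit S (x - y).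
Proof. by move=> jx jy; rewrite nonunitD ?nonunit_opp. Qed.
Lemma nonunit_sum (I : Type) (r : seq I) (P : pred I) (F : I -> K) :
  (forall i, P i -> nonunit S (F i)) -> nonunit S (\sum_(i <- r | P i) F i).
Proof.
by move=> h; apply: (big_ind (nonunit S)) => //; [exact: nonunit0|exact: nonunitD].
Qed.
Lemma unitD x y : unit_of S x -> nonunit S y -> unit_of S (x + y).
Proof.
move=> ux jy; rewrite -nonunit_unitE ?valD ?(unit_val ux) ?(nonunit_val jy) //.
apply/negP => h; have := nonunitB h jy.
by rewrite addrK unit_nonunitF.
Qed.
(** A proper ideal contains no unit, so the nonunits form the only maximal ideal. From here on the
    decidable [nonunit] stands for the radical. *)
Lemma radicalP x : radical S x <-> nonunit S x.
Proof.
have maxJ : maximal_left_ideal *%R (fun x => x \in S) (nonunit S).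
  split.
  - split=> [y /nonunit_val //||y z|a y]; [exact: nonunit0|exact: nonunitB|exact: nonunitMl].
  - by exists 1; rewrite val1 nonunit1.
  - move=> N [N1 _ _ N4] JN; case: (boolp.pselect (exists2 y, N y & unit_of S y)).
      case=> y Ny uy; right=> z; split=> [/N1 //|Sz].
      rewrite -[z](divfK (unit_neq0 uy)); apply: N4 => //.
      by apply: valM => //; apply: unit_valV.
    move=> n; left=> z; split=> [Nz|/JN //]; rewrite /nonunit (N1 _ Nz) /=.
    by apply/negP => uz; apply: n; exists z.
split=> [[_ /(_ _ maxJ)] //|jx]; split; first exact: nonunit_val.
move=> M [[M1 M2 M3 M4] [a [Sa nMa]] M5].
have MJ y : M y -> nonunit S y.
  move=> My; rewrite /nonunit (M1 _ My); apply/negP => uy; apply: nMa.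
  by rewrite -[a](divfK (unit_neq0 uy)); apply: M4 => //; apply: valM => //; apply: unit_valV.
case: maxJ => lJ _ _; case: (M5 _ lJ MJ) => h; first by apply/h.
by have /h := val1; rewrite nonunit1.
Qed.

(** Of two elements one divides the other, so a1 b1 + a2 b2 can be factored with the common divisor
    among a1, a2 pulled out; a sum of products collapses to one product. *)
Lemma radical_sqP x : radical_sq S x -> x = 0 \/
  exists a b, [/\ nonunit S a, nonunit S b & x = a * b].
Proof.
case=> n [a [b [jab ->]]]; apply: (big_ind (fun x : K => x = 0 \/
  exists a b, [/\ nonunit S a, nonunit S b & x = a * b])); first by left.
- move=> y z [->|[a1 [b1 [ja1 jb1 ->]]]]; first by rewrite add0r.
  case=> [->|[a2 [b2 [ja2 jb2 ->]]]]; first by rewrite addr0; right; exists a1, b1.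
  case: (eqVneq a1 0) => [->|a10]; first by rewrite mul0r add0r; right; exists a2, b2.
  case: (eqVneq a2 0) => [->|a20]; first by rewrite mul0r addr0; right; exists a1, b1.
  right; case: (val_div a10 a20) => h.
    exists a2, (a1 / a2 * b1 + b2); split=> //; first by apply: nonunitD => //; apply: nonunitMl.
    by field.
  exists a1, (b1 + a2 / a1 * b2); split=> //; first by apply: nonunitD => //; apply: nonunitMl.
  by field.
- by move=> i _; right; exists (a i), (b i); split=> //; apply/radicalP; case: (jab i).
Qed.

Lemma radical_sqM a b : nonunit S a -> nonunit S b -> radical_sq S (a * b).
Proof.
move=> ja jb; exists 1%N, (fun=> a), (fun=> b); split; last by rewrite big_ord1.
by move=> _; split; apply/radicalP.
Qed.

(** A coordinate of least valuation: dividing by it makes the vector integral with a coordinate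
    1. *)
Lemma max_coord (X : eqType) (v : X -> K) (r : seq X) : has (fun x : X => v x != 0) r ->
  exists x : X, [/\ x \in r, v x != 0 & forall y : X, y \in r -> v y / v x \in S].
Proof.
elim: r => //= a r IH.
case: (boolP (has _ r)) => [/IH [x [xr x0 h]] _|].
  case: (eqVneq (v a) 0) => [a0|a0].
    exists x; split=> //; first by rewrite inE xr orbT.
    by move=> y; rewrite inE => /predU1P[->|/h //]; rewrite a0 mul0r val0.
  case: (val_div a0 x0) => hax.
    exists x; split=> //; first by rewrite inE xr orbT.
    by move=> y; rewrite inE => /predU1P[->|/h //].
  exists a; split; rewrite ?inE ?eqxx //.
  move=> y; rewrite inE => /predU1P[->|/h hy]; first by rewrite divff ?val1.
  have -> : v y / v a = v y / v x * (v x / v a) by field; apply/andP.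
  exact: valM.
rewrite orbF => /hasPn h0 a0; exists a; split; rewrite ?inE ?eqxx //.
move=> y; rewrite inE => /predU1P[->|/h0]; first by rewrite divff ?val1.
by rewrite negbK => /eqP ->; rewrite mul0r val0.
Qed.

End Valuation.
(** * The radical and projectivity in a concrete ring *)

Section ConcreteRingTheory.
Variables (T : zmodType) (mul : T -> T -> T) (A : T -> Prop) (one : T).
Hypothesis mulA : associative mul.
Hypothesis mulDl : left_distributive mul +%R.
Hypothesis mulDr : right_distributive mul +%R.
Hypothesis mul1l : left_id one mul.
Hypothesis mul1r : right_id one mul.
Hypothesis A1 : A one.
Hypothesis AB : forall x y, A x -> A y -> A (x - y).
Hypothesis AM : forall x y, A x -> A y -> A (mul x y).

Let mulBl x y z : mul (x - y) z = mul x z - mul y z.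
Proof. by apply: (addIr (mul y z)); rewrite -mulDl !subrK. Qed.
Let mul0 x : mul 0 x = 0.
Proof. by rewrite -(subrr one) mulBl !subrr. Qed.
Let A0 : A 0. Proof. by rewrite -(subrr one); apply: AB. Qed.
Let AD x y : A x -> A y -> A (x + y).
Proof.
move=> Ax Ay; have -> : x + y = x - (0 - y) by rewrite sub0r opprK.
by apply: AB => //; apply: AB.
Qed.

(** If y lay outside a maximal left ideal M, then A y + M would contain 1 = a y + m, and m = 1 - a
    y, being left invertible, would put everything into M. *)
Lemma left_inv_jacobson y : A y ->
  (forall b, A b -> exists2 a, A a & mul a (one - mul b y) = one) ->
  jacobson mul A y.
Proof.
move=> Ay inv; split=> // M [[M1 M2 M3 M4] [u [Au nMu]] maxM].
pose N x := exists2 a, A a & exists2 m, M m & x = mul a y + m.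
have lN : left_ideal mul A N.
  split=> [x [a Aa [m /M1 Am ->]]||x z [a Aa [m Mm ->]] [b Ab [k Mk ->]]|b x Ab [a Aa [m Mm ->]]].
  - by apply: AD => //; apply: AM.
  - by exists 0 => //; exists 0; rewrite // mul0 addr0.
  - exists (a - b); first exact: AB.
    by exists (m - k); [apply: M3|rewrite mulBl opprD addrACA].
  - exists (mul b a); first exact: AM.
    by exists (mul b m); [apply: M4|rewrite mulDr mulA].
have MN m : M m -> N m by move=> Mm; exists 0 => //; exists m; rewrite // mul0 add0r.
have Ny : N y by exists one => //; exists 0; rewrite // mul1l addr0.
case: (maxM N lN MN) => h; first exact/h.
have [a Aa [m Mm e]] : N one by apply/h.
have [b Ab eb] := inv a Aa; case: nMu; rewrite -[u]mul1r; apply (M4 u one Au).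
by rewrite -eb e [mul a y + m]addrC addrK; apply: M4.
Qed.

(** Otherwise the left ideal generated by 1 - b y is proper; Zorn's lemma puts it in a maximal one,
    which also contains y and hence 1. *)
Lemma jacobson_left_inv y b : jacobson mul A y -> A b ->
  exists2 a, A a & mul a (one - mul b y) = one.
Proof.
move=> [Ay hy] Ab; set u := one - mul b y.
have Au : A u by apply: AB => //; apply: AM.
case: (boolp.pselect (exists2 a, A a & mul a u = one)) => // nu; exfalso.
pose P (N : T -> Prop) := [/\ left_ideal mul A N, N u & ~ N one].
have P0 : P (fun x => exists2 a, A a & mul a u = x).
  split=> //; last by exists one; rewrite ?mul1l.
  split=> [x [a Aa <-]||x z [a Aa <-] [c Ac <-]|c x Ac [a Aa <-]].
  - exact: AM.
  - by exists 0; rewrite ?mul0.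
  - by exists (a - c); [apply: AB|rewrite mulBl].
  - by exists (mul c a); [apply: AM|rewrite mulA].
pose D := {N : T -> Prop | P N}.
pose R (N N' : D) := boolp.asbool (forall x, sval N x -> sval N' x).
have [||[N PN] [N' PN']|C totC|[M [lM Mu nM1]] maxM] := @classical_sets.Zorn D R.
- by move=> N; apply/boolp.asboolP.
- by move=> N1 N2 N3 /boolp.asboolP h /boolp.asboolP h'; apply/boolp.asboolP; auto.
- move=> /boolp.asboolP /= h /boolp.asboolP /= h'.
  have e : N = N' by apply: boolp.funext => x; apply: boolp.propext; split; auto.
  by case: _ / e in PN' h h' *; congr exist; apply: boolp.Prop_irrelevance.
- case: (boolp.pselect (exists N, C N)) => [[N0 CN0]|nC]; last first.
    by exists (exist _ _ P0) => N CN; case: nC; exists N.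
  have PU : P (fun x => exists2 N : D, C N & sval N x).
    split; last by case=> [[N [l1 l2 l3]]] /=.
      split=> [x [[N [[h1 _ _ _] _ _]] /= _ /h1 //]||x z [N CN Nx] [N' CN' Nz]|a x Aa [N CN Nx]].
      + by exists N0 => //; case: (svalP N0) => [[]].
      + case: (totC _ _ CN CN') => /boolp.asboolP h.
          by exists N' => //; case: (svalP N') => [[_ _ h3 _] _ _]; apply: h3 => //; apply: h.
        by exists N => //; case: (svalP N) => [[_ _ h3 _] _ _]; apply: h3 => //; apply: h.
      + by exists N => //; case: (svalP N) => [[_ _ _ h4] _ _]; apply: h4.
    by exists N0 => //; case: (svalP N0).
  by exists (exist _ _ PU) => N CN; apply/boolp.asboolP => x Nx; exists N.
have MM : maximal_left_ideal mul A M.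
  split=> // [|N lN MN]; first by exists one.
  case: (boolp.pselect (N one)) => No.
    right=> x; split=> [|Ax]; first by case: lN => h _ _ _; apply: h.
    by rewrite -[x]mul1r; case: lN => _ _ _ h; apply: h.
  left=> x; have PN : P N by split=> //; apply: MN.
  have := maxM (exist _ N PN) (introT (boolp.asboolP _) MN).
  by move/(congr1 (fun N : D => sval N)) => /= ->.
have [_ _ M3 M4] := lM; apply/nM1.
have -> : one = u - (0 - mul b y) by rewrite sub0r opprK subrK.
apply/M3 => //; apply/M3; first by have [] := lM.
exact: (M4 b y Ab (hy M MM)).
Qed.
End ConcreteRingTheory.

(** * Transport of projectivity along an anti-isomorphism *)

Section Opposite.
Variables (T : zmodType) (mul mul' : T -> T -> T) (A : T -> Prop) (th : T -> T).
Hypothesis thK : involutive th.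
Hypothesis thB : {morph th : x y / x - y}.
Hypothesis thA : forall x, A x -> A (th x).
Hypothesis thM : forall x y, th (mul x y) = mul' (th y) (th x).

Lemma anti_projective :
  (forall I, fg_left_ideal mul' A I -> projective_left mul' A I) ->
  forall I, fg_right_ideal mul A I -> projective_right mul A I.
Proof.
move=> hl I [[I1 I2 I3 I4] [n [g [gI hI]]]].
have th0 : th 0 = 0 by rewrite -(subrr 0) thB !subrr.
have thD x y : th (x + y) = th x + th y.
  by rewrite -{1}[y]opprK -[- y]sub0r !thB th0 sub0r opprK.
have th_sum (r : seq 'I_n) (F : 'I_n -> T) : th (\sum_(i <- r) F i) = \sum_(i <- r) th (F i).
  exact: (big_morph th thD th0).
have thM' x y : th (mul' x y) = mul (th y) (th x) by rewrite -{1}[x]thK -{1}[y]thK -thM thK.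
have [|k [p [j [h1 h2 h3 h4 h5]]]] := hl (fun x => I (th x)).
  split.
    split=> [x /I1/thA|| x y Ix Iy|a x Aa Ix].
    - by rewrite thK.
    - by rewrite th0.
    - by rewrite thB; apply: I3.
    - by rewrite thM'; apply: I4 => //; apply: thA.
  exists n, (fun i => th (g i)); split=> [i|x]; first by rewrite thK.
  split=> [/hI[c [Ac e]]|[c [Ac ->]]].
    exists (fun i => th (c i)); split=> [i|]; first exact: thA.
    by rewrite -[x]thK e th_sum; apply: eq_bigr => i _; rewrite thM.
  apply/hI; exists (fun i => th (c i)); split=> [i|]; first exact: thA.
  by rewrite th_sum; apply: eq_bigr => i _; rewrite thM' thK.
exists k, (fun v => th (p (fun i => th (v i)))), (fun x i => th (j (th x) i)); split.
- by move=> v Av; apply: h1 => i; apply: thA.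
- move=> a v w Aa Av Aw.
  have -> : (fun i => th (mul (v i) a + w i)) = (fun i => mul' (th a) (th (v i)) + th (w i)).
    by apply: boolp.funext => i; rewrite thD thM.
  by rewrite h2 ?thD ?thM' ?thK //; [exact: thA|move=> i; exact: thA|move=> i; exact: thA].
- by move=> x Ix i; apply: thA; apply: h3; rewrite thK.
- move=> a x y Aa Ix Iy; apply: boolp.funext => i.
  by rewrite thD thM h4 ?thK ?thD ?thM' ?thK //; exact: thA.
- move=> x Ix; have -> : (fun i => th (th (j (th x) i))) = j (th x).
    by apply: boolp.funext => i; rewrite thK.
  by rewrite h5 ?thK.
Qed.

End Opposite.

Lemma free_linear_sum (T : zmodType) (mul : T -> T -> T) (A : T -> Prop) (one : T)
    (n : nat) (p : ('I_n -> T) -> T) :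
  (forall x, mul x 0 = 0) -> right_id one mul -> A one -> A 0 ->
  (forall x y, A x -> A y -> A (x + y)) ->
  (forall a v w, A a -> (forall i, A (v i)) -> (forall i, A (w i)) ->
     p (fun i => mul a (v i) + w i) = mul a (p v) + p w) ->
  left_id one mul ->
  forall v, (forall i, A (v i)) ->
    p v = \sum_k mul (v k) (p (fun i => if i == k then one else 0)).
Proof.
move=> mul0 mul1r A1 A0 AD plin mul1l v Av.
have p0 : p (fun=> 0) = 0.
  have := plin one (fun=> 0) (fun=> 0) A1 (fun=> A0) (fun=> A0).
  rewrite (_ : (fun i => _) = (fun=> 0)); last first.
    by apply: boolp.funext => i; rewrite mul0 addr0.
  by rewrite mul1l => /(congr1 (fun x => x - p (fun=> 0))); rewrite subrr addrK.
pose e k := (fun i : 'I_n => if i == k then one else 0).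
have eA k i : A (e k i) by rewrite /e; case: ifP.
(* Linearity of [p] is available only for families with entries in [A], so the induction also
   carries that the partial sums stay in [A]. *)
have main (r : seq 'I_n) : p (fun i => \sum_(k <- r) mul (v k) (e k i)) =
    \sum_(k <- r) mul (v k) (p (e k)) /\ forall i, A (\sum_(k <- r) mul (v k) (e k i)).
  elim: r => [|k r [IH1 IH2]].
    split; last by move=> i; rewrite big_nil.
    by rewrite big_nil -[RHS]p0; congr p; apply: boolp.funext => i; rewrite big_nil.
  have ek i : A (mul (v k) (e k i)) by rewrite /e; case: ifP => _; rewrite ?mul1r ?mul0.
  split; last by move=> i; rewrite big_cons; apply: AD.
  rewrite big_cons -IH1 -plin //; congr p; apply: boolp.funext => i.
  by rewrite big_cons.
have [em _] := main (enum 'I_n); rewrite -[RHS]big_enum -[RHS]em.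
congr p; apply: boolp.funext => i; rewrite big_enum (bigD1 i) //= big1 => [|k /negPf ne].
  by rewrite /e eqxx mul1r addr0.
by rewrite /e eq_sym ne mul0.
Qed.
(** * Lattices over a valuation ring *)

Section Lattice.
Variables (L : fieldType) (S : {pred L}) (X : finType).
Hypothesis valS : valuation_ring S.
Local Notation M := {ffun X -> L^o}.
Implicit Types (v w z : M) (x y : X).

Lemma scalE a v x : (a *: v) x = a * (v x : L) :> L.
Proof. by rewrite ffunE. Qed.

Definition lattice v := forall x, (v x : L) \in S.

Lemma lattice0 : lattice 0. Proof. by move=> x; rewrite ffunE val0. Qed.
Lemma latticeD v w : lattice v -> lattice w -> lattice (v + w).
Proof. by move=> hv hw x; rewrite ffunE; apply: valD. Qed.
Lemma latticeN v : lattice v -> lattice (- v).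
Proof. by move=> hv x; rewrite ffunE; apply: valN. Qed.
Lemma latticeB v w : lattice v -> lattice w -> lattice (v - w).
Proof. by move=> hv hw; apply: latticeD => //; apply: latticeN. Qed.
Lemma latticeZ a v : a \in S -> lattice v -> lattice (a *: v).
Proof. by move=> Sa hv x; rewrite scalE; apply: valM. Qed.
Lemma lattice_sum (I : Type) (r : seq I) (P : pred I) (F : I -> M) :
  (forall i, P i -> lattice (F i)) -> lattice (\sum_(i <- r | P i) F i).
Proof. by move=> h; apply: (big_ind lattice) => //; [exact: lattice0|exact: latticeD]. Qed.

Lemma lattice_normalize v : v != 0 -> exists s x,
  [/\ s != 0, lattice (s *: v) & (s *: v) x = 1].
Proof.
move=> v0; have hx : has (fun x => (v x : L) != 0) (enum X).
  apply/hasP; case: (boolP [exists x, (v x : L) != 0]) => [/existsP[x h]|].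
    by exists x => //; rewrite mem_enum.
  rewrite negb_exists => /forallP h; case/eqP: v0; apply/ffunP => x.
  by rewrite ffunE; apply/eqP; rewrite -[_ == _]negbK; apply: h.
have [x [_ x0 h]] := @max_coord L S valS X (fun x => v x : L) _ hx.
exists (v x : L)^-1, x; split; first by rewrite invr_eq0.
  by move=> y; rewrite scalE mulrC h ?mem_enum.
by rewrite scalE; apply: mulVf.
Qed.

(* Gaussian elimination: any z0 in Z with a coordinate equal to 1 splits off.    *)
(* Used with Q = 0 (exact projection) and with Q = congruence modulo the radical. *)
Lemma lattice_projection (Y : pred X) (Z Q : M -> Prop) :
  (forall z, Z z -> lattice z) -> Z 0 ->
  (forall a z w, a \in S -> Z z -> Z w -> Z (a *: z + w)) ->
  (forall z, Z z -> Q z \/ exists s x, [/\ Y x, Z (s *: z) & (s *: z) x = 1]) ->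
  exists rho : M -> M, [/\ linear rho, forall v, lattice v -> Z (rho v),
    forall v, (forall y, Y y -> v y = 0) -> rho v = 0
  & forall z, Z z -> Q (z - rho z)].
Proof.
move=> ZE Z0 ZD ZQ.
have [n hn] : exists n, exists2 D : {set X}, (#|D| <= n)%N &
    forall z, Z z -> forall x, x \notin D -> z x = 0.
  by exists #|X|, setT => [|z _ x]; rewrite ?cardsT ?inE.
elim: n Z ZE Z0 ZD ZQ hn => [|n IH] Z ZE Z0 ZD ZQ [D Dn hD].
  exists (fun=> 0); split=> // [a v w|z Zz]; first by rewrite scaler0 addr0.
  rewrite subr0; case: (ZQ z Zz) => // -[s [x [_ Zs e]]].
  move: Dn e; rewrite leqn0 cards_eq0 => /eqP D0.
  by rewrite (hD _ Zs) ?D0 ?inE // => /eqP; rewrite eq_sym oner_eq0.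
case: (boolp.pselect (forall z, Z z -> Q z)) => [hQ|/boolp.existsNP[z1]].
  exists (fun=> 0); split=> // [a v w|z Zz]; first by rewrite scaler0 addr0.
  by rewrite subr0; apply: hQ.
move/boolp.not_implyP=> [Zz1 nQ]; case: (ZQ z1 Zz1) => // -[s [x0 [Yx0 Zz0 e0]]].
set z0 := s *: z1 in Zz0 e0; clearbody z0; pose Z' z := Z z /\ z x0 = 0.
case: (IH Z') => [z [/ZE //]||a z w Sa [Zz xz] [Zw xw]|z [Zz xz]||rho [lin rZ rY rQ]].
- by split=> //; rewrite ffunE.
- by split; [apply: ZD|rewrite !ffunE xz xw scaler0 addr0].
- case: (ZQ z Zz) => [|[t [y [Yy Zt e]]]]; [by left|right; exists t, y; split=> //].
  by split=> //; rewrite ffunE xz scaler0.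
- exists (D :\ x0) => [|z [Zz xz] x].
    have : x0 \in D.
      by apply: contraT => /(hD _ Zz0); rewrite e0 => /eqP; rewrite oner_eq0.
    by move=> Dx0; move: Dn; rewrite (cardsD1 x0 D) Dx0.
  rewrite !inE negb_and negbK => /orP[/eqP -> //|]; exact: hD.
have ZZ z a : a \in S -> Z z -> Z (a *: z).
  by move=> Sa Zz; rewrite -[_ *: _]addr0; apply: ZD.
pose sub v := v - (v x0 : L) *: z0.
have sub_lin : linear sub.
  move=> a v w; have e : (a *: v + w) x0 = a * (v x0 : L) + w x0 :> L by rewrite !ffunE.
  by rewrite /sub e scalerBr scalerDl scalerA opprD addrACA.
have sub0 v : sub v x0 = 0 by rewrite !ffunE e0 [_ *: 1]mulr1 subrr.
exists (fun v => (v x0 : L) *: z0 + rho (sub v)); split.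
- move=> a v w; have e : (a *: v + w) x0 = a * (v x0 : L) + w x0 :> L by rewrite !ffunE.
  by rewrite sub_lin lin e scalerDr scalerDl scalerA addrACA.
- move=> v Ev; have /rZ[Zr _] : lattice (sub v).
    by apply: latticeB => //; apply: latticeZ => //; apply: ZE.
  by apply: ZD.
- move=> v hv; rewrite /sub (hv x0) // !scale0r subr0 add0r; exact: rY.
- move=> z Zz; rewrite opprD addrA; apply: rQ; split; last exact: sub0.
  rewrite /sub addrC -scaleNr; apply: ZD => //; apply: valN => //; exact: ZE.
Qed.

(** Since u^N vanishes modulo J, the geometric series suggests that 1 - u is invertible on the
    lattice. No completeness is assumed: invertibility comes from dimension over the field,
    integrality of the inverse from normalizing vectors. *)
Lemma nakayama (u : M -> M) (N : nat) : linear u ->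
  (forall v, lattice v -> lattice (u v)) ->
  (forall v, lattice v -> forall x, nonunit S (iter N u v x : L)) ->
  exists Th : M -> M, [/\ forall v, lattice v -> lattice (Th v),
    forall v, Th v - u (Th v) = v & forall v, Th (v - u v) = v].
Proof.
move=> ulin uE uJ.
pose U : {linear M -> M} := HB.pack u (GRing.isLinear.Build _ _ _ _ u ulin).
have iterZ k a v : iter k u (a *: v) = a *: iter k u v.
  by elim: k => //= k ->; rewrite -[u]/(U : _ -> _) linearZ.
have iterE k v : lattice v -> lattice (iter k u v) by move=> Ev; elim: k => //= k; apply: uE.
have iterB k v : v - iter k u v = \sum_(i < k) iter i u (v - u v).
  elim: k => [|k IHk]; first by rewrite big_ord0 subrr.
  rewrite big_ord_recr /= -IHk.
  have -> : iter k u (v - u v) = iter k u v - iter k.+1 u v.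
    by elim: k {IHk} => //= k ->; rewrite -[u]/(U : _ -> _) linearB.
  by rewrite addrA subrK.
(* If v is not integral, a nonunit s makes s v integral with a coordinate 1. By telescoping, s v -
   u^N (s v) is s times an integral vector, so that coordinate would be a nonunit. *)
have C v : lattice (v - u v) -> lattice v.
  move=> h; case: (eqVneq v 0) => [->|/lattice_normalize[s [x [s0 Es ex]]]].
    exact: lattice0.
  case: (boolP (s^-1 \in S)) => [Ss|nS].
    by rewrite -[v](scalerK s0); apply: latticeZ.
  have js : nonunit S s by rewrite -[s]invrK; apply: nonunit_inv.
  have : nonunit S ((s *: v - iter N u (s *: v)) x : L).
    rewrite iterB sum_ffunE; apply: nonunit_sum => // i _.
    have -> : s *: v - u (s *: v) = s *: (v - u v).
      by rewrite -[u]/(U : _ -> _) linearZ scalerBr.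
    by rewrite iterZ scalE; apply: nonunitMr => //; apply: iterE.
  move/(nonunitD valS)/(_ (uJ _ Es x)).
  have -> : forall w z : M, (w - z) x + z x = w x :> L.
    by move=> w z; rewrite !ffunE subrK.
  by rewrite ex nonunit1.
pose W : {linear M -> M} := (idfun \- U)%R.
have WE v : W v = v - u v by [].
(* A nonzero fixed vector of u, normalized to have a coordinate 1, equals its image under u^N, whose
   coordinates are nonunits. *)
have kW : lker (linfun W) == 0%VS.
  apply/lker0P => v w; rewrite !lfunE => /eqP; rewrite -subr_eq0 -linearB.
  rewrite WE subr_eq0 => /eqP ud; apply/eqP; rewrite -subr_eq0.
  move: (v - w) ud => d ud; apply: contraT => /lattice_normalize[s [x [s0 Es ex]]].
  have idd k : iter k u d = d by elim: k => //= k ->.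
  by have := uJ _ Es x; rewrite iterZ idd ex nonunit1.
exists ((linfun W)^-1)%VF; split.
- move=> v Ev; apply: C; rewrite -WE.
  by have := lker0_lfunVK kW v; rewrite lfunE => ->.
- by move=> v; rewrite -WE; have := lker0_lfunVK kW v; rewrite lfunE.
- by move=> v; rewrite -WE; have := lker0_lfunK kW v; rewrite lfunE.
Qed.

End Lattice.
(** * Crossed products *)

Section Crossed.
Variables (L : fieldType) (S : {pred L}) (gT : finGroupType).
Variable ga : gT -> {rmorphism L -> L}.
Hypothesis valS : valuation_ring S.
Hypothesis ga1 : forall a, ga 1%g a = a.
Hypothesis gaM : forall s t a, ga (s * t)%g a = ga t (ga s a).
Hypothesis gaS : forall s a, a \in S -> ga s a \in S.

Lemma gaK s : cancel (ga s) (ga s^-1%g).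
Proof. by move=> a; rewrite -gaM mulgV ga1. Qed.
Lemma gaKV s : cancel (ga s^-1%g) (ga s).
Proof. by move=> a; rewrite -gaM mulVg ga1. Qed.
Lemma ga_val s a : (ga s a \in S) = (a \in S).
Proof. by apply/idP/idP => [|/gaS //]; rewrite -{2}(gaK s a) => /gaS. Qed.
Lemma ga_unit s a : unit_of S (ga s a) = unit_of S a.
Proof. by rewrite /unit_of ga_val fmorph_eq0 -fmorphV ga_val. Qed.
Lemma ga_nonunit s a : nonunit S (ga s a) = nonunit S a.
Proof. by rewrite /nonunit ga_val ga_unit. Qed.

(* The norm of ga s a / a under the cyclic group of s is 1. *)
Lemma ga_div_unit s a : a != 0 -> unit_of S (ga s a / a).
Proof.
move=> a0; have s0 : ga s a != 0 by rewrite fmorph_eq0.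
have main b : nonunit S b -> \prod_(i < #[s]%g) ga (s ^+ i)%g b = 1 -> False.
  move=> jb; have := order_gt0 s; case: #[s]%g => // n _ e.
  have : nonunit S (1 : L).
    rewrite -e big_ord_recl /= expg0 ga1; apply: nonunitMr => //.
    apply: (big_ind (fun x => x \in S)) => [||i _]; [exact: val1|exact: valM|].
    by rewrite ga_val nonunit_val.
  by rewrite nonunit1.
have tele : \prod_(i < #[s]%g) ga (s ^+ i)%g (ga s a / a) = 1.
  have e k : \prod_(i < k) ga (s ^+ i)%g (ga s a / a) = ga (s ^+ k)%g a / a.
    elim: k => [|k IH]; first by rewrite big_ord0 expg0 ga1 divff.
    rewrite big_ord_recr /= IH fmorph_div -gaM -expgS.
    have : ga (s ^+ k)%g a != 0 by rewrite fmorph_eq0.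
    by move: a0 => /[swap] h h'; field; apply/andP.
  by rewrite e expg_order ga1 divff.
case: (boolP (ga s a / a \in S)) => Sb.
  by rewrite -nonunit_unitE //; apply/negP => /main; apply.
have jb := nonunit_inv valS Sb; case: (main _ jb).
have := congr1 GRing.inv tele; rewrite invr1 -prodfV => e; rewrite -[RHS]e.
by apply: eq_bigr => i _; rewrite fmorphV.
Qed.

(* MathComp composes automorphisms from left to right, hence x_s x_t is a *)
(* multiple of x_(t * s).                                                 *)
Variable f : gT -> gT -> L.
Hypothesis fS : forall s t, f s t \in S.
Hypothesis f_neq0 : forall s t, f s t != 0.
Hypothesis f1l : forall s, f 1%g s = 1.
Hypothesis f1r : forall s, f s 1%g = 1.
Hypothesis fco : forall s t u,
  ga s (f t u) * f s (u * t)%g = f s t * f (t * s)%g u.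

(** The cocycle identity at (s, s^-1, s o t): f(s, s^-1) is a multiple of every value in row s, so
    its being a unit makes the whole row units. *)
Lemma f_dvd s t : ga s (f s^-1 (t * s))%g * f s t = f s s^-1%g.
Proof. by have := fco s s^-1%g (t * s)%g; rewrite mulgK mulVg f1l mulr1. Qed.
Lemma f_inv s : ga s (f s^-1 s)%g = f s s^-1%g.
Proof. by have := f_dvd s 1%g; rewrite f1r mulr1 mul1g. Qed.

Definition unit_part := [set s | unit_of S (f s s^-1%g)].
Local Notation H := unit_part.

Lemma f_unitl s t : s \in H -> unit_of S (f s t).
Proof. by rewrite inE -(f_dvd s t); apply: unitMr => //; rewrite ga_val. Qed.
Lemma f_unitr s t : t \in H -> unit_of S (f s t).
Proof.
move=> tH; have := fco s t t^-1%g; rewrite mulVg f1r mulr1 => e.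
by apply: (@unitMl _ _ valS _ (f (t * s) t^-1)%g); rewrite // -e ga_unit f_unitl.
Qed.
Lemma group_set_unit_part : group_set H.
Proof.
apply/group_setP; split=> [|t s tH sH]; first by rewrite inE f1l unit1.
rewrite inE; have := fco s t (t * s)^-1%g => e.
apply: (@unitMr _ _ valS (f s t)) => //.
by rewrite -e unitM ?ga_unit ?f_unitl.
Qed.
Canonical unit_part_group := Group group_set_unit_part.

(* Equivalently, x_s A_f consists of the a in A_f with a_t in J(S) for t in H. *)
Definition uniformizing (s : gT) := forall t,
  if t \in H then nonunit S (f s (t * s^-1)%g) /\
                  forall a, nonunit S a -> a / f s (t * s^-1)%g \in S
  else unit_of S (f s (t * s^-1)%g).

(** * Left multiplication by x_s on free modules *)

Section Operators.
Variables (X : finType) (act : X -> gT -> X) (pr : X -> gT).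
Hypothesis act1 : forall x, act x 1%g = x.
Hypothesis actM : forall x s t, act (act x s) t = act x (s * t)%g.
Hypothesis prM : forall x s, pr (act x s) = (pr x * s)%g.
Local Notation M := {ffun X -> L^o}.
Implicit Types (v w : M) (x : X) (a b : L).

(* Left multiplication by x_s on a free left module over the crossed product *)
(* K-algebra; act is right translation on the index set X = gT or I x gT,    *)
(* and pr is the gT-component.                                              *)
Definition Xop (s : gT) v : M :=
  [ffun x => ga s (v (act x s^-1%g)) * f s (pr x * s^-1)%g].

Lemma XopE s v x : Xop s v x = ga s (v (act x s^-1%g)) * f s (pr x * s^-1)%g :> L.
Proof. by rewrite ffunE. Qed.
Lemma Xop_semilinear s a v w : Xop s (a *: v + w) = ga s a *: Xop s v + Xop s w.
Proof.
apply/ffunP => x.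
have e (y z : M) : (y + z) x = (y x : L) + z x :> L by rewrite ffunE.
rewrite e scalE !XopE ffunE [(a *: v) _]scalE rmorphD rmorphM mulrDl -mulrA.
by [].
Qed.

Lemma Xop0 s : Xop s 0 = 0.
Proof. by apply/ffunP => x; rewrite XopE !ffunE rmorph0 mul0r. Qed.
Lemma XopD s v w : Xop s (v + w) = Xop s v + Xop s w.
Proof. by have := Xop_semilinear s 1 v w; rewrite rmorph1 !scale1r. Qed.
Lemma XopZ s a v : Xop s (a *: v) = ga s a *: Xop s v.
Proof. by have := Xop_semilinear s a v 0; rewrite Xop0 !addr0. Qed.
Lemma XopB s v w : Xop s (v - w) = Xop s v - Xop s w.
Proof. by rewrite XopD -scaleN1r XopZ rmorphN1 scaleN1r. Qed.
Lemma Xop_sum (I : Type) (r : seq I) (P : pred I) (F : I -> M) s :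
  Xop s (\sum_(i <- r | P i) F i) = \sum_(i <- r | P i) Xop s (F i).
Proof. by apply: (big_morph (Xop s)); [exact: XopD|exact: Xop0]. Qed.

Lemma XopM s t v : Xop s (Xop t v) = f s t *: Xop (t * s)%g v.
Proof.
apply/ffunP => x; rewrite scalE !XopE rmorphM prM actM -invMg -gaM.
set u := (pr x * s^-1 * t^-1)%g.
have := fco s t u; rewrite /u mulgKV -mulgA -invMg => e.
by rewrite -mulrA e; ring.
Qed.
Lemma Xop1 v : Xop 1%g v = v.
Proof. by apply/ffunP => x; rewrite XopE invg1 act1 ga1 f1l mulr1. Qed.

Lemma Xop_lattice s v : lattice S v -> lattice S (Xop s v).
Proof. by move=> Ev x; rewrite XopE valM // ga_val. Qed.

Definition Xinv s v := Xop s^-1%g ((f s s^-1%g)^-1 *: v).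
Lemma XinvK s v : Xop s (Xinv s v) = v.
Proof. by rewrite XopM mulVg Xop1 scalerA divff ?scale1r. Qed.
Lemma XopK s v : Xinv s (Xop s v) = v.
Proof.
rewrite /Xinv XopZ XopM mulgV Xop1 scalerA fmorphV -[X in _ * X](gaK s) f_inv.
by rewrite mulVf ?scale1r // fmorph_eq0.
Qed.
Lemma Xop_inj s : injective (Xop s). Proof. exact: can_inj (XopK s). Qed.
Lemma Xinv_semilinear s a v w :
  Xinv s (a *: v + w) = ga s^-1%g a *: Xinv s v + Xinv s w.
Proof. by rewrite /Xinv scalerDr scalerA mulrC -scalerA Xop_semilinear. Qed.
Lemma Xinv_lattice s v : s \in H -> lattice S v -> lattice S (Xinv s v).
Proof.
move=> sH Ev; apply: Xop_lattice; apply: latticeZ => //.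
by apply: unit_valV; apply: f_unitl.
Qed.

(** The point of the orbit of [x] whose group component is 1; the vectors [delta] at such points
    generate the free module over the crossed product. *)
Definition base x := act x (pr x)^-1%g.
Definition delta x : M := [ffun y => (y == x)%:R].
Lemma delta_base x : delta x = Xop (pr x) (delta (base x)).
Proof.
apply/ffunP => y; rewrite XopE !ffunE /base.
case: (eqVneq y x) => [->|ne]; first by rewrite eqxx mulgV f1r mulr1 [RHS]rmorph1.
case: eqP => [e|_]; last by rewrite !mulr0n [ga _ 0]rmorph0 mul0r.
by case/eqP: ne; have := congr1 (act^~ (pr x)) e; rewrite !actM !mulVg !act1.
Qed.
Lemma delta_sum v : v = \sum_x v x *: delta x.
Proof.
apply/ffunP => y; rewrite sum_ffunE (bigD1 y) //= big1 => [|x ne].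
  by rewrite addr0 scalE ffunE eqxx mulr1.
by rewrite scalE ffunE eq_sym (negPf ne) mulr0.
Qed.
Lemma lattice_delta x : lattice S (delta x).
Proof. by move=> y; rewrite ffunE; case: eqP => _; rewrite ?val1 ?val0. Qed.

(* The linear map commuting with all Xop s that sends each basis vector *)
(* delta b, b a base point, to z b.                                     *)
Definition extend (z : X -> M) v : M := \sum_x v x *: Xop (pr x) (z (base x)).

Lemma extend_linear z : linear (extend z).
Proof.
move=> a v w; rewrite /extend scaler_sumr -big_split; apply: eq_bigr => x _ /=.
have -> : (a *: v + w) x = a * (v x : L) + w x :> L by rewrite !ffunE.
by rewrite scalerDl scalerA.
Qed.
Lemma extend_lattice z v :
  (forall x, lattice S (z x)) -> lattice S v -> lattice S (extend z v).
Proof.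
by move=> Ez Ev; apply: lattice_sum => // x _; apply: latticeZ => //; apply: Xop_lattice.
Qed.
Lemma Xop_extend z s v : Xop s (extend z v) = extend z (Xop s v).
Proof.
rewrite Xop_sum [RHS](reindex_inj (h := act^~ s)) => [|x y e]; last first.
  by rewrite -(act1 x) -(act1 y) -(mulgV s) -!actM e.
apply: eq_bigr => x _ /=; rewrite XopZ XopM scalerA XopE actM mulgV act1 prM mulgK.
by rewrite /base prM actM invMg mulKVg.
Qed.

(** * Maschke averaging over H *)

Section Average.
Variable c : L.
Hypothesis c_trace : \sum_(h in H) ga h c = 1.
Hypothesis cS : c \in S.

(* Maschke averaging over H, twisted by an element of trace 1. *)
Definition average (rho : M -> M) v := \sum_(h in H) Xop h (c *: rho (Xinv h v)).

Variable rho : M -> M.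
Hypothesis rho_lin : linear rho.

Let rhoZ a v : rho (a *: v) = a *: rho v.
Proof.
have e : rho 0 = 0 by have := rho_lin (-1) 0 0; rewrite !scaleN1r oppr0 addr0 addNr.
by have := rho_lin a v 0; rewrite e !addr0.
Qed.

Lemma average_linear : linear (average rho).
Proof.
move=> a v w; rewrite /average scaler_sumr -big_split; apply: eq_bigr => h _ /=.
rewrite Xinv_semilinear rho_lin scalerDr scalerA [c * _]mulrC -scalerA.
by rewrite Xop_semilinear gaKV.
Qed.

(** Reindex by h -> h * s. The scalar that [Xinv] then picks up from the cocycle passes through the
    linear [rho] and is the one produced by [XopM] on the other side. *)
Lemma average_Xop s v : s \in H -> Xop s (average rho v) = average rho (Xop s v).
Proof.
move=> sH; rewrite Xop_sum [RHS](reindex_inj (mulIg s)) /=.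
apply: eq_big => [h|h hH]; first by rewrite groupMr.
set k := (h * s)%g.
have -> : Xinv k (Xop s v) = ga k^-1%g (f s h) *: Xinv h v.
  by apply: (@Xop_inj k); rewrite XinvK XopZ gaKV -XopM XinvK.
by rewrite rhoZ scalerA [c * _]mulrC -scalerA [in RHS]XopZ gaKV XopM.
Qed.

(** Averaging the identity gives the identity, by trace one; hence averaging preserves being the
    identity on a stable submodule, exactly or modulo a submodule stable under H. *)
Lemma average_id v : v = \sum_(h in H) Xop h (c *: Xinv h v).
Proof.
rewrite -[LHS]scale1r -c_trace scaler_suml; apply: eq_bigr => h _.
by rewrite XopZ XinvK.
Qed.

Lemma average_stable (Z : M -> Prop) v : Z 0 ->
  (forall a z w, a \in S -> Z z -> Z w -> Z (a *: z + w)) ->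
  (forall s z, Z z -> Z (Xop s z)) -> (forall w, lattice S w -> Z (rho w)) ->
  lattice S v -> Z (average rho v).
Proof.
move=> Z0 ZD ZX rZ Ev.
apply: (big_ind Z) => // [z w Zz Zw|h hH]; first by rewrite -[z]scale1r; apply: ZD => //; exact: val1.
by apply: ZX; rewrite -[_ *: _]addr0; apply: ZD => //; apply: rZ; apply: Xinv_lattice.
Qed.

End Average.

(** The submodule x_s0 A^n described without s0, as [radical_latticeP] shows for every uniformizing
    s0. *)
Definition radical_lattice v :=
  lattice S v /\ forall x, pr x \in H -> nonunit S (v x : L).

Lemma radical_lattice0 : radical_lattice 0.
Proof. by split=> [|x _]; [exact: lattice0|rewrite ffunE nonunit0]. Qed.
Lemma radical_latticeD v w :
  radical_lattice v -> radical_lattice w -> radical_lattice (v + w).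
Proof.
case=> Ev hv [Ew hw]; split=> [|x xH]; first exact: latticeD.
by rewrite ffunE; apply: nonunitD; auto.
Qed.
Lemma radical_latticeZ a v : a \in S -> radical_lattice v -> radical_lattice (a *: v).
Proof.
move=> Sa [Ev hv]; split=> [|x xH]; first exact: latticeZ.
by rewrite scalE; apply: nonunitMl => //; apply: hv.
Qed.
Lemma radical_lattice_sum (I : Type) (r : seq I) (P : pred I) (F : I -> M) :
  (forall i, P i -> radical_lattice (F i)) ->
  radical_lattice (\sum_(i <- r | P i) F i).
Proof.
by move=> h; apply: (big_ind radical_lattice) => //;
  [exact: radical_lattice0|exact: radical_latticeD].
Qed.
Lemma radical_lattice_Xop s v : s \in H -> radical_lattice v -> radical_lattice (Xop s v).
Proof.
move=> sH [Ev hv]; split=> [|x xH]; first exact: Xop_lattice.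
by rewrite XopE nonunitMr // ga_nonunit hv // prM groupMr // groupV.
Qed.

Section Uniformizer.
Variable s0 : gT.
Hypothesis uni : uniformizing s0.

Lemma radical_latticeP v :
  radical_lattice v <-> exists2 w, lattice S w & v = Xop s0 w.
Proof.
split=> [[Ev hv]|[w Ew ->]]; last first.
  split=> [|x xH]; first exact: Xop_lattice.
  have [xf _] : nonunit S (f s0 (pr x * s0^-1)%g) /\
                  forall a, nonunit S a -> a / f s0 (pr x * s0^-1)%g \in S.
    by have := uni (pr x); rewrite xH.
  by rewrite XopE nonunitMl // ga_val.
exists [ffun y => ga s0^-1%g ((v (act y s0) : L) / f s0 (pr y))].
  move=> y; rewrite ffunE ga_val; have := uni (pr y * s0)%g.
  rewrite mulgK -prM; case: ifP => [yH [_ h]|_ u]; first by apply: h; apply: hv.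
  by apply: valM => //; apply: unit_valV.
apply/ffunP => x; rewrite XopE ffunE gaKV prM actM mulVg act1.
by rewrite divfK.
Qed.

Lemma radical_lattice_extend z v : (forall x, lattice S (z x)) ->
  radical_lattice v -> radical_lattice (extend z v).
Proof.
move=> Ez /radical_latticeP[w Ew ->]; rewrite -Xop_extend.
by apply/radical_latticeP; exists (extend z w) => //; apply: extend_lattice.
Qed.

Variable c : L.
Hypothesis c_trace : \sum_(h in H) ga h c = 1.
Hypothesis cS : c \in S.

(** The averaged map commutes with x_h for h in H, and a basis vector over H is x_h applied to one
    at a base point. So on the coordinates over H it agrees with a map commuting with every x_s, and
    it kills the others. *)
Lemma average_extend rho v : linear rho ->
  (forall v, (forall y, pr y \in H -> v y = 0) -> rho v = 0) ->
  average c rho v = extend (fun x => average c rho (delta x))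
    [ffun x => if pr x \in H then v x else 0].
Proof.
move=> rlin r0; set v1 := [ffun x => _].
have alin : linear (average c rho) by exact: average_linear.
pose A : {linear M -> M} := HB.pack (average c rho)
  (GRing.isLinear.Build _ _ _ _ (average c rho) alin).
have AE w : average c rho w = A w by [].
have -> : v = v1 + (v - v1) by rewrite addrC subrK.
rewrite AE linearD [X in _ + X](_ : _ = 0) ?addr0.
  rewrite [in LHS](delta_sum v1) linear_sum; apply: eq_bigr => x _.
  have e : v1 x = if pr x \in H then v x else 0 by rewrite ffunE.
  rewrite linearZZ e; case: ifP => [xH|_]; last by rewrite !scale0r.
  by rewrite [in LHS]delta_base -AE -average_Xop.
rewrite -AE; apply: big1 => h hH; rewrite r0 ?scaler0 ?Xop0 // => y yH.
rewrite /Xinv XopE scalE !ffunE prM invgK groupMr // yH subrr mulr0 rmorph0 mul0r.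
by [].
Qed.

(** Modulo x_s0 only the coordinates over H survive, where the cocycle has unit values. Project onto
    [Z] modulo J there, average over H, and extend from the base points to a map commuting with all
    x_s. *)
Lemma radical_splitting (Z : M -> Prop) :
  (forall z, Z z -> lattice S z) -> Z 0 ->
  (forall a z w, a \in S -> Z z -> Z w -> Z (a *: z + w)) ->
  (forall s z, Z z -> Z (Xop s z)) ->
  exists2 z : X -> M, forall x, Z (z x)
    & forall v, Z v -> radical_lattice (v - extend z v).
Proof.
move=> ZE Z0 ZD ZX.
have ZZ a z : a \in S -> Z z -> Z (a *: z).
  by move=> Sa Zz; rewrite -[_ *: _]addr0; apply: ZD.
have [z Zz|rho [rlin rZ rY rQ]] := @lattice_projection L S X valS
  [pred x | pr x \in H] Z (fun v => forall x, pr x \in H -> nonunit S (v x : L)) ZE Z0 ZD.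
  case: (boolp.pselect (forall x, pr x \in H -> nonunit S (z x : L))); first by left.
  move=> /boolp.existsNP[x /boolp.not_implyP[xH /negP]].
  rewrite nonunit_unitE; last exact: ZE.
  move=> ux; right; exists (z x : L)^-1, x; split=> //.
    by apply: ZZ => //; apply: unit_valV.
  by rewrite scalE mulVf // (unit_neq0 ux).
have az w : lattice S w -> Z (average c rho w) by apply: average_stable.
exists (fun x => average c rho (delta x)) => [x|v Zv]; first by apply: az; apply: lattice_delta.
set z := fun x => _.
have Ez x : lattice S (z x) by apply: ZE; apply: az; apply: lattice_delta.
pose v1 : M := [ffun x => if pr x \in H then v x else 0].
(* The average of v is [extend z v1]. The first difference is an average of errors of [rho], which
   are small over H; in the second, v - v1 vanishes over H, so it already lies in the radical
   lattice, which [extend] preserves. *)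
have -> : v - extend z v = (v - average c rho v) - extend z (v - v1).
  rewrite (average_extend v rlin rY) -/z -/v1.
  have -> : v - v1 = -1 *: v1 + v by rewrite scaleN1r addrC.
  by rewrite extend_linear scaleN1r opprD opprK addrA subrK.
apply: radical_latticeD.
  rewrite [X in X - _](average_id c_trace v) /average -sumrB.
  apply: radical_lattice_sum => h hH.
  rewrite -XopB -scalerBr; apply: radical_lattice_Xop => //.
  apply: radical_latticeZ => //.
  have Zh : Z (Xinv h v).
    by apply: ZX; apply: ZZ => //; apply: unit_valV; apply: f_unitl.
  split; last exact: rQ.
  by apply: latticeB => //; [exact: ZE|exact/ZE/rZ/ZE].
rewrite -scaleN1r; apply: radical_latticeZ; first by rewrite valN ?val1.
apply: radical_lattice_extend => //; split=> [|x xH].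
  apply: latticeB => // [|x]; first exact: ZE.
  by rewrite ffunE; case: ifP => _; [exact: ZE|exact: val0].
by rewrite !ffunE xH subrr nonunit0.
Qed.
(** With N the order of s0, x_s0^(N-1) is a multiple of x_(s0^-1), so x_s0^N is a scalar divisible
    by f(s0, s0^-1), a nonunit. *)
Lemma iter_Xop v : lattice S v ->
  forall x, nonunit S (iter #[s0]%g (Xop s0) v x : L).
Proof.
move=> Ev x; have [n en] : exists n, #[s0]%g = n.+1.
  by have := order_gt0 s0; case: #[s0]%g => // n _; exists n.
have it k : exists2 a, a \in S & iter k (Xop s0) v = a *: Xop (s0 ^+ k)%g v.
  elim: k => [|k [a Sa IH]]; first by exists 1; rewrite ?val1 // scale1r Xop1.
  exists (ga s0 a * f s0 (s0 ^+ k)%g); first by rewrite valM ?ga_val.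
  by rewrite iterS IH XopZ XopM scalerA -expgSr.
rewrite en iterS; have [a Sa ->] := it n.
have ej : (s0 ^+ n)%g = s0^-1%g.
  by apply: (mulIg s0); rewrite -expgSr -en expg_order mulVg.
rewrite XopZ XopM scalerA scalE ej mulVg Xop1.
apply: nonunitMr => //; apply: nonunitMl => //; first by rewrite ?ga_val.
by have := uni 1%g; rewrite group1 mul1g => -[].
Qed.

End Uniformizer.

(** * Equivariant retractions onto a stable subspace *)

Section Retraction.
Variable W : M -> Prop.
Hypothesis W0 : W 0.
Hypothesis WD : forall a v w, W v -> W w -> W (a *: v + w).
Hypothesis WX : forall s v, W v -> W (Xop s v).

Let WZ a v : W v -> W (a *: v).
Proof. by move=> Wv; rewrite -[_ *: _]addr0; apply: WD. Qed.
Let WB v w : W v -> W w -> W (v - w).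
Proof. by move=> Wv Ww; rewrite addrC -scaleN1r; apply: WD. Qed.

(** Normalizing an integral vector of the subspace [W] stays in [W], so Gaussian elimination leaves
    no error. Non-integral vectors also land in [W], being scalar multiples of integral ones. *)
Lemma saturated_projection : exists rho : M -> M, [/\ linear rho,
  forall v, lattice S v -> lattice S (rho v), forall v, W (rho v)
  & forall z, lattice S z -> W z -> rho z = z].
Proof.
have [||a z w Sa [Ez Wz] [Ew Ww]|z [Ez Wz]|rho [rlin rZ _ rI]] :=
  @lattice_projection L S X valS predT (fun v => lattice S v /\ W v) (fun v => v = 0).
- by move=> z [].
- by split=> //; apply: lattice0.
- by split; [apply: latticeD => //; apply: latticeZ|apply: WD].
- case: (eqVneq z 0) => [|/(lattice_normalize valS)[s [x [s0 Es ex]]]]; [by left|right].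
  by exists s, x; split=> //; split=> //; apply: WZ.
pose R : {linear M -> M} := HB.pack rho (GRing.isLinear.Build _ _ _ _ rho rlin).
exists rho; split=> // [v /rZ[]//|v|z Ez Wz].
  case: (eqVneq v 0) => [->|/(lattice_normalize valS)[s [x [sn0 Es ex]]]].
    by rewrite -[rho]/(R : _ -> _) linear0.
  rewrite -[v](scalerK sn0) -[rho]/(R : _ -> _) linearZZ; apply: WZ.
  by case: (rZ _ Es).
by apply/eqP; rewrite eq_sym -subr_eq0; apply/eqP; apply: rI.
Qed.

Variable c : L.
Hypothesis c_trace : \sum_(h in H) ga h c = 1.
Hypothesis cS : c \in S.

Definition equivariant_retraction (e : M -> M) := [/\ linear e,
  forall s v, e (Xop s v) = Xop s (e v), forall v, lattice S v -> lattice S (e v),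
  forall v, lattice S v -> W (e v) & forall z, lattice S z -> W z -> e z = z].

Lemma retraction_unit : (forall s, s \in H) -> exists e, equivariant_retraction e.
Proof.
move=> hH; have [rho [rlin rE rW rI]] := saturated_projection.
exists (average c rho); split.
- exact: average_linear.
- by move=> s v; rewrite average_Xop.
- move=> v Ev; refine (@average_stable c cS rho (fun w => lattice S w) v _ _ _ _ Ev) => //.
  + exact: lattice0.
  + by move=> a z w Sa Ez Ew; apply: latticeD => //; apply: latticeZ.
  + by move=> s z; apply: Xop_lattice.
- move=> v Ev; refine (@average_stable c cS rho W v _ _ _ _ Ev) => //.
  by move=> a z w _; apply: WD.
- move=> z Ez Wz; rewrite [RHS](average_id c_trace z); apply: eq_bigr => h hh.
  by rewrite rI //; [exact: Xinv_lattice|apply: WX; apply: WZ].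
Qed.

(** The map [r] from [radical_splitting] commutes with all x_s and sends the lattice into [Z], but
    is the identity of [Z] only modulo x_s0 Z. On [W] it equals 1 - U with [U] nilpotent modulo J,
    so Nakayama inverts it there, and the inverse composed with [r] is a retraction. *)
Lemma retraction_uniformizing s0 : uniformizing s0 -> exists e, equivariant_retraction e.
Proof.
move=> uni; have [rho [rlin rhoE rhoW rI]] := saturated_projection.
pose Z v := lattice S v /\ W v.
have Z0 : Z 0 by split=> //; apply: lattice0.
have ZD a z w : a \in S -> Z z -> Z w -> Z (a *: z + w).
  move=> Sa [Ez Wz] [Ew Ww]; split; last exact: WD.
  by apply: latticeD => //; apply: latticeZ.
have ZX s z : Z z -> Z (Xop s z).
  by case=> Ez Wz; split; [apply: Xop_lattice|apply: WX].
have [|z zZ zQ] := @radical_splitting s0 uni c c_trace cS Z _ Z0 ZD ZX; first by move=> z [].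
have rE v : lattice S v -> Z (extend z v).
  move=> Ev; split; first by apply: extend_lattice => // x; case: (zZ x).
  apply: (big_ind W) => // [x y Wx Wy|x _]; first by rewrite -[x]scale1r; apply: WD.
  by apply: WZ; apply: WX; case: (zZ (base x)).
have elin := extend_linear z.
pose r : {linear M -> M} := HB.pack (extend z)
  (GRing.isLinear.Build _ _ _ _ (extend z) elin).
pose R : {linear M -> M} := HB.pack rho (GRing.isLinear.Build _ _ _ _ rho rlin).
have rX s v : r (Xop s v) = Xop s (r v) by rewrite /= Xop_extend.
have rW v : W (r v).
  case: (eqVneq v 0) => [->|/(lattice_normalize valS)[s [x [sn0 Es ex]]]].
    by rewrite linear0.
  by rewrite -[v](scalerK sn0) linearZZ; apply: WZ; case: (rE _ Es).
have rhoE' v : lattice S v -> Z (rho v) by move=> Ev; split; [apply: rhoE|apply: rhoW].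
(* The quotient by x_s0 is integral by [radical_latticeP], and lies in [W] because [W] is a subspace
   stable under [Xinv s0]. *)
have rZ y : Z y -> exists2 y', Z y' & y - r y = Xop s0 y'.
  move=> Zy; have /(radical_latticeP uni)[w Ew ew] := zQ y Zy.
  exists w => //; split=> //; rewrite -(XopK s0 w) -ew /Xinv; apply: WX; apply: WZ.
  by case: Zy => Ey Wy; apply: WB => //; apply: rW.
pose U v := rho v - r (rho v).
have Ulin : linear U.
  move=> a v w; rewrite /U rlin linearD linearZZ scalerBr opprD -!addrA.
  by congr (_ + _); rewrite addrCA.
have ZB y y' : Z y -> Z y' -> Z (y - y').
  by move=> Zy Zy'; rewrite addrC -scaleN1r; apply: ZD; rewrite ?valN ?val1.
have UE v : lattice S v -> Z (U v).
  by move=> Ev; have Zr := rhoE' v Ev; apply: ZB => //; case: Zr => /rE.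
(* On [Z] the operator [U] is 1 - r, which commutes with x_s0, so each application contributes one
   more factor x_s0. *)
have iterUZ k y : Z y -> exists2 y', Z y' & iter k U y = iter k (Xop s0) y'.
  move=> Zy; elim: k => [|k [y' Zy' IH]]; first by exists y.
  have Zi : Z (iter k (Xop s0) y') by elim: k {IH} => //= k; apply: ZX.
  have [y2 Zy2 e2] := rZ _ Zy'; exists y2 => //.
  have [Ei Wi] := Zi; rewrite iterS IH /U rI // iterSr -e2.
  elim: k {IH Zi Ei Wi} => //= k IH.
  by rewrite -IH XopB Xop_extend.
(* One application of [U] more than the order of s0: the first moves an arbitrary lattice vector
   into [Z]. *)
have [||Th [ThE Th1 Th2]] := @nakayama L S X valS U #[s0]%g.+1 Ulin.
- by move=> v /UE[].
- move=> v Ev x; rewrite iterSr.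
  by have [y [Ey _] ->] := iterUZ #[s0]%g _ (UE v Ev); apply: iter_Xop.
have UI y : W y -> y - U y = r y.
  move=> Wy; suff e : rho y = y by rewrite /U e opprB addrC subrK.
  case: (eqVneq y 0) => [->|/(lattice_normalize valS)[s [x [sn0 Es ex]]]].
    by rewrite -[rho]/(R : _ -> _) linear0.
  rewrite -[y](scalerK sn0) -[rho]/(R : _ -> _) linearZZ; congr (_ *: _).
  by apply: rI => //; apply: WZ.
have UW v : W (U v) by apply: WB; [apply: rhoW|apply: rW].
have ThW v : W v -> W (Th v).
  by move=> Wv; rewrite -[Th v](subrK (U (Th v))) Th1 -[v]scale1r; apply: WD.
exists (fun v => Th (r v)); split.
- move=> a v w; rewrite linearD linearZZ -[RHS]Th2; congr Th.
  have -> : U (a *: Th (r v) + Th (r w)) = a *: U (Th (r v)) + U (Th (r w)) by apply: Ulin.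
  by rewrite opprD addrACA -scalerBr !Th1.
- move=> s v; rewrite rX -[RHS]Th2; congr Th.
  have Wt : W (Th (r v)) by apply: ThW.
  rewrite [RHS]UI; last exact: WX.
  by rewrite rX -[r (Th _)]UI // Th1.
- by move=> v /rE[/ThE].
- by move=> v Ev; apply: ThW; apply: rW.
- by move=> w Ew Ww; rewrite -UI.
Qed.
End Retraction.

End Operators.

(** * The additive weight cocycle and the chain of cosets *)

Section Weights.
Hypothesis nosq : forall s t a b, nonunit S a -> nonunit S b -> f s t <> a * b.

Let w s t : nat := nonunit S (f s t).
Let N := #|gT|.

(** In the identity A B = C E none of the four factors is a product of two nonunits, so both sides
    contain equally many nonunits. If A is a unit and C, E are not, then B = (A^-1 C) E is forbidden
    ([key]); a unit product has unit factors ([key0]). *)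
Lemma weight_cocycle s t u : (w t u + w s (u * t) = w s t + w (t * s) u)%N.
Proof.
rewrite /w -(ga_nonunit s (f t u)).
have := fco s t u.
have q1 : forall a b, nonunit S a -> nonunit S b -> ga s (f t u) <> a * b.
  move=> a b ja jb e; apply: (@nosq t u (ga s^-1%g a) (ga s^-1%g b)).
  - by rewrite ga_nonunit.
  - by rewrite ga_nonunit.
  - by rewrite -rmorphM -e gaK.
have S1 : ga s (f t u) \in S by rewrite ga_val.
move: (ga s (f t u)) q1 S1 => A qA SA.
have qB := @nosq s (u * t)%g; have qC := @nosq s t; have qD := @nosq (t * s)%g u.
have SB := fS s (u * t)%g; have SC := fS s t; have SD := fS (t * s)%g u.
move: (f s (u * t))%g (f s t) (f (t * s) u)%g qB qC qD SB SC SD => B C E qB qC qD SB SC SE e.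
have key a b c d : a \in S -> b \in S -> c \in S -> d \in S ->
    (forall x y, nonunit S x -> nonunit S y -> b <> x * y) ->
    a * b = c * d -> ~~ nonunit S a -> nonunit S c -> nonunit S d -> False.
  move=> Sa Sb Sc Sd qb eq ua jc jd; rewrite nonunit_unitE // in ua.
  have a0 := unit_neq0 ua; apply: (qb (a^-1 * c) d) => //.
    by apply: nonunitMl => //; apply: unit_valV.
  by rewrite -mulrA -eq mulKf.
have key0 a b c d : a \in S -> b \in S -> c \in S -> d \in S ->
    a * b = c * d -> ~~ nonunit S a -> ~~ nonunit S b -> nonunit S (c * d) -> False.
  move=> Sa Sb Sc Sd <- ua ub; rewrite !nonunit_unitE // in ua ub.
  by rewrite unit_nonunitF // unitM.
case jA: (nonunit S A); case jB: (nonunit S B); case jC: (nonunit S C); case jE: (nonunit S E) => //; exfalso.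
- by apply: (key E C A B) => //; [rewrite mulrC|rewrite jE].
- by apply: (key C E A B) => //; rewrite jC.
- by apply: (key0 C E A B) => //; rewrite ?jC ?jE //; apply: nonunitMl.
- by apply: (key B A C E) => //; [rewrite mulrC|rewrite jB].
- by apply: (key0 C E A B) => //; rewrite ?jC ?jE //; apply: nonunitMr.
- by apply: (key A B C E) => //; rewrite jA.
- by apply: (key0 C E A B) => //; rewrite ?jC ?jE //; apply: nonunitMl.
- by apply: (key0 A B C E) => //; rewrite ?jA ?jB //; apply: nonunitMl.
- by apply: (key0 A B C E) => //; rewrite ?jA ?jB //; apply: nonunitMr.
- by apply: (key0 A B C E) => //; rewrite ?jA ?jB //; apply: nonunitMl.
Qed.

(* phi / N splits the weight cocycle over the rationals. *)
Let phi s : nat := \sum_t w s t.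

Lemma phiM s t : (phi s + phi t = N * w s t + phi (t * s))%N.
Proof.
have -> : phi s = (\sum_u w s (u * t))%N.
  by rewrite /phi (reindex_inj (mulIg t)).
rewrite addnC -big_split /= (eq_bigr (fun u => w s t + w (t * s) u)%N).
  by rewrite big_split /= sum_nat_const.
by move=> u _; apply: weight_cocycle.
Qed.

Lemma weight1 s : w s 1 = 0%N. Proof. by rewrite /w f1r nonunit1. Qed.
Lemma weight_eq0 s t : (w s t == 0%N) = unit_of S (f s t).
Proof. by rewrite /w eqb0 nonunit_unitE. Qed.
Lemma weight_le1 s t : (w s t <= 1)%N. Proof. by rewrite /w leq_b1. Qed.

Lemma phi_lt s : (phi s < N)%N.
Proof.
rewrite /phi (bigD1 1%g) //= weight1 add0n.
apply: leq_ltn_trans (_ : (\sum_(t | t != 1%g) 1 < N)%N).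
  by apply: leq_sum => t _; apply: weight_le1.
rewrite sum1_card /N (cardD1 (1%g : gT) gT) inE /= ltnS.
by apply: subset_leq_card; apply/subsetP => t; rewrite !inE andbT.
Qed.

Lemma phi_eq0 s : (phi s == 0%N) = (s \in H).
Proof.
apply/idP/idP => [|sH].
  rewrite sum_nat_eq0 => /forall_inP h; have := h s^-1%g isT.
  by rewrite weight_eq0 inE.
by rewrite sum_nat_eq0; apply/forall_inP => t _; rewrite weight_eq0; exact: f_unitl.
Qed.

Lemma phi_Hmul h s : h \in H -> phi (h * s) = phi s.
Proof.
move=> hH; have := phiM s h.
have /eqP -> : phi h == 0%N by rewrite phi_eq0.
have /eqP -> : w s h == 0%N by rewrite weight_eq0 f_unitr.
by rewrite muln0 add0n addn0.
Qed.

(** From h s = s h^s and the invariance of phi under H, phi(h^s) is a multiple of |G|; being smaller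
    than |G|, it is 0. *)
Lemma unit_part_normal : (H <| [set: gT])%g.
Proof.
apply/andP; split; first exact: subsetT.
apply/normsP => s _; apply/eqP; rewrite eqEcard cardJg leqnn andbT.
apply/subsetP => _ /imsetP[h hH ->]; rewrite -phi_eq0.
have := phiM (h ^ s)%g s; rewrite -conjgC (phi_Hmul s hH) => /eqP.
rewrite eqn_add2r => /eqP e; have := phi_lt (h ^ s)%g; rewrite e.
by case: (w _ _) => [|k]; rewrite ?muln0 // mulnS ltnNge leq_addr.
Qed.

Section Generator.
Variable s0 : gT.
Hypothesis s0H : s0 \notin H.
Hypothesis s0min : forall s, s \notin H -> (phi s0 <= phi s)%N.

Let phi0 : (0 < phi s0)%N. Proof. by rewrite lt0n phi_eq0. Qed.

(** For t in H the sum phi(s0) + phi(t s0^-1) is positive, so the weight is 1, and a nonunit not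
    divisible by this value of f would be a proper factor of it, against [nosq]. For t outside H,
    weight 1 would give phi(t) < phi(s0). *)
Lemma minimal_uniformizing : uniformizing s0.
Proof.
move=> t; have := phiM s0 (t * s0^-1)%g; rewrite mulgKV.
case: ifP => [tH|/negbT tH].
  have /eqP -> : phi t == 0%N by rewrite phi_eq0.
  rewrite addn0 => e.
  have jf : nonunit S (f s0 (t * s0^-1)%g).
    apply: contraTT phi0 => nj; rewrite -leqNgt.
    by have: (phi s0 + phi (t * s0^-1) == 0)%N; [rewrite e /w (negPf nj) muln0|rewrite addn_eq0 => /andP[/eqP ->]].
  split=> // a ja; case: (eqVneq a 0) => [->|a0]; first by rewrite mul0r val0.
  apply: contraT => /(nonunit_inv valS); rewrite invf_div => jb.
  case: (nosq (s := s0) (t := (t * s0^-1)%g) ja jb).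
  by rewrite mulrC divfK.
move=> e; rewrite -weight_eq0; apply: contraT => w0.
have wE1 : w s0 (t * s0^-1)%g = 1%N.
  by apply/eqP; rewrite eqn_leq weight_le1 lt0n.
rewrite wE1 muln1 in e; have := leq_add (s0min tH) (phi_lt (t * s0^-1)%g).
by rewrite addnS e [(N + _)%N]addnC ltnn.
Qed.

Lemma phi_div s : s \notin H -> phi (s * s0^-1)%g = (phi s - phi s0)%N.
Proof.
move=> sH; have := minimal_uniformizing s; rewrite (negPf sH) -weight_eq0 => /eqP e.
have := phiM s0 (s * s0^-1)%g; rewrite mulgKV e muln0 add0n => <-.
by rewrite addKn.
Qed.

(** Descent: outside H, dividing by s0 lowers phi by phi(s0) > 0. *)
Lemma unit_part_coset s : exists h k, h \in H /\ s = (h * s0 ^+ k)%g.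
Proof.
have [n] := ubnP (phi s); elim: n s => // n IH s sn.
case: (boolP (s \in H)) => [sH|sH]; first by exists s, 0%N; rewrite mulg1.
have [|h [k [hH e]]] := IH (s * s0^-1)%g.
  rewrite phi_div //; apply: (@leq_trans (phi s)) => //.
  by rewrite ltn_subrL phi0 lt0n phi_eq0.
by exists h, k.+1; split=> //; rewrite expgSr mulgA -e mulgKV.
Qed.

Lemma quotient_unit_part : ([set: gT] / H)%g = <[coset H s0]>%g.
Proof.
have nH s : s \in 'N(H)%g by case/andP: unit_part_normal => _ /subsetP; apply; rewrite inE.
apply/eqP; rewrite eqEsubset; apply/andP; split.
  apply/subsetP => _ /morphimP[s _ _ ->]; have [h [k [hH ->]]] := unit_part_coset s.
  by rewrite morphM ?nH // [coset_morphism _ h]coset_id // mul1g morphX ?nH // mem_cycle.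
by rewrite cycle_subG mem_quotient ?inE.
Qed.

Lemma expg_notin i : (0 < i < #|([set: gT] / H)%g|)%N -> (s0 ^+ i)%g \notin H.
Proof.
case/andP=> i0 im; apply/negP => sH.
have nH s : s \in 'N(H)%g by case/andP: unit_part_normal => _ /subsetP; apply; rewrite inE.
have : (coset H s0 ^+ i == 1)%g by rewrite -morphX ?nH //= coset_id.
rewrite -order_dvdn => /(dvdn_leq i0).
by rewrite /order -quotient_unit_part leqNgt im.
Qed.

Lemma phi_exp i : (i < #|([set: gT] / H)%g|)%N -> phi (s0 ^+ i)%g = (i * phi s0)%N.
Proof.
elim: i => [|i IH] im; first by apply/eqP; rewrite mul0n phi_eq0 group1.
have := phi_div (expg_notin (i := i.+1) im); rewrite expgSr mulgK IH ?(ltnW im) // => e.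
have := s0min (expg_notin (i := i.+1) im); rewrite expgSr => h.
by rewrite mulSn e subnKC.
Qed.

(** With phi(s0^i) = i phi(s0), the relation reads i phi(s0) + phi(u) = |G| w + j phi(s0); since 0
    <= phi(u) < |G|, the weight is 0 exactly when i <= j. *)
Lemma graph_chain i j : (i < #|([set: gT] / H)%g|)%N -> (j < #|([set: gT] / H)%g|)%N ->
  unit_of S (f (s0 ^+ i) (s0 ^+ j * (s0 ^+ i)^-1))%g = (i <= j)%N.
Proof.
move=> im jm; rewrite -weight_eq0.
have := phiM (s0 ^+ i)%g (s0 ^+ j * (s0 ^+ i)^-1)%g.
rewrite mulgKV !phi_exp //; set u := (_ * _^-1)%g => e.
case: leqP => ij; last first.
  apply: contraTF ij => /eqP w0; rewrite w0 muln0 add0n in e.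
  by rewrite -leqNgt -(leq_pmul2r phi0) -e leq_addr.
apply: contraT => wn; have wE1 : w (s0 ^+ i)%g u = 1%N.
  by apply/eqP; rewrite eqn_leq weight_le1 lt0n.
rewrite wE1 muln1 in e; have := phi_lt u.
rewrite -(ltn_add2l (i * phi s0)) e addnC ltn_add2r ltnNge.
by rewrite leq_mul2r ij orbT.
Qed.
End Generator.

Lemma unit_or_uniformizing : (forall s, s \in H) \/ exists s0, [/\ uniformizing s0,
  ([set: gT] / H)%g = <[coset H s0]>%g &
  forall i j, (i < #|([set: gT] / H)%g|)%N -> (j < #|([set: gT] / H)%g|)%N ->
    unit_of S (f (s0 ^+ i) (s0 ^+ j * (s0 ^+ i)^-1))%g = (i <= j)%N].
Proof.
case: (boolP [forall s, s \in H]) => [/forallP|]; first by left.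
rewrite negb_forall => /existsP[s1 s1H]; right.
case: (@arg_minnP gT s1 [pred s | s \notin H] phi s1H) => s0 s0H s0min; exists s0; split.
- exact: minimal_uniformizing.
- exact: quotient_unit_part.
- by move=> i j; apply: graph_chain.
Qed.
End Weights.
(** f(s, t) divides f(s, s^-1), which is a unit for s in H and otherwise an associate of q = f(s0,
    s0^-1). As q divides every nonunit, a product a b of nonunits dividing q would make b a unit. *)
Lemma chain_nosq s0 : (H <| [set: gT])%g -> ([set: gT] / H)%g = <[coset H s0]>%g ->
  (forall i j, (i < #|([set: gT] / H)%g|)%N -> (j < #|([set: gT] / H)%g|)%N ->
    unit_of S (f (s0 ^+ i) (s0 ^+ j * (s0 ^+ i)^-1))%g = (i <= j)%N) ->
  (forall a, nonunit S a -> exists2 a', a' \in S & a = a' * f s0 s0^-1%g) ->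
  forall s t a b, nonunit S a -> nonunit S b -> f s t <> a * b.
Proof.
move=> nH gen chain qdiv s t a b ja jb est.
have nHs r : r \in 'N(H)%g by case/andP: nH => _ /subsetP; apply; rewrite inE.
have Hgen r : exists h i, [/\ h \in H, (i < #|([set: gT] / H)%g|)%N & r = (h * s0 ^+ i)%g].
  have : coset H r \in <[coset H s0]>%g by rewrite -gen mem_quotient ?inE.
  case/cyclePmin => i im; rewrite -morphX ?nHs //= => e.
  exists (r * (s0 ^+ i)^-1)%g, i; split; rewrite ?mulgKV //; last by rewrite gen.
  by apply: coset_idr; rewrite ?nHs // morphM ?nHs // morphV ?nHs //= e mulgV.
have [h [i [hH im er]]] := Hgen s.
set m := #|_| in chain im.
have eq1 : ga (s0 ^+ i)%g (f h s^-1%g) * f (s0 ^+ i)%g (s0 ^+ i)^-1%g =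
    f (s0 ^+ i)%g h * f s s^-1%g.
  have := fco (s0 ^+ i)%g h s^-1%g; rewrite -er.
  by have -> : (s^-1 * h = (s0 ^+ i)^-1)%g by rewrite er invMg mulgKV.
have u1 : unit_of S (ga (s0 ^+ i)%g (f h s^-1%g)) by rewrite ga_unit f_unitl.
have u2 : unit_of S (f (s0 ^+ i)%g h) by apply: f_unitr.
have Szz : ga s (f s^-1 (t * s))%g \in S by rewrite ga_val.
have ess := f_dvd s t; rewrite est in ess.
have nu : ~~ unit_of S (f s s^-1%g).
  by apply: nonunit_not_unit; rewrite -ess; apply: nonunitMl => //; apply: nonunitMr => //; apply: nonunit_val.
case: i im er eq1 u1 u2 => [|i] im er eq1 u1 u2.
  case/negP: nu; rewrite expg0 in eq1 u2 u1 *.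
  apply: (@unitMr _ _ valS (f 1%g h)) => //.
  by rewrite -eq1 invg1 f1l mulr1.
have i0m : (i < m)%N by apply: ltnW.
have m1 : (1 < m)%N by apply: leq_ltn_trans im.
have eq2 : ga s0 (f (s0 ^+ i) (s0 ^+ i.+1)^-1)%g * f s0 s0^-1%g =
    f s0 (s0 ^+ i)%g * f (s0 ^+ i.+1)%g (s0 ^+ i.+1)^-1%g.
  by have := fco s0 (s0 ^+ i)%g (s0 ^+ i.+1)^-1%g; rewrite -expgSr expgSr invMg mulgKV.
have u3 : unit_of S (f s0 (s0 ^+ i)%g).
  by have := chain 1%N i.+1 m1 im; rewrite expg1 expgSr mulgK => ->.
have kH : (s0 ^+ m)%g \in H.
  apply: coset_idr; rewrite ?nHs // morphX ?nHs //=.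
  by rewrite /m gen; apply: expg_order.
(* Modulo H the element s0^-(i+1) is s0^(m-1-i), so this is the edge from s0^i to s0^(m-1) of the
   chain, up to values of f at elements of H. *)
have u4 : unit_of S (f (s0 ^+ i) (s0 ^+ i.+1)^-1)%g.
  have := fco (s0 ^+ i)%g (s0 ^+ i.+1)^-1%g (s0 ^+ m)%g => e.
  apply: (@unitMl _ _ valS _ (f ((s0 ^+ i.+1)^-1 * s0 ^+ i) (s0 ^+ m))%g) => //.
  rewrite -e; apply: unitM => //; first by rewrite ga_unit f_unitr.
  have := chain i m.-1 i0m _; rewrite (ltn_predK im) leqnn => /(_ isT).
  have -> : (s0 ^+ m.-1 * (s0 ^+ i)^-1 = s0 ^+ m * (s0 ^+ i.+1)^-1)%g.
    by rewrite -[in RHS](ltn_predK im) !expgSr invMg mulgA mulgK.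
  by move=> ->; rewrite -ltnS (ltn_predK im).
have [a' Sa' ea] := qdiv a ja.
set q := f s0 s0^-1%g in ea eq2; have q0 : q != 0 by exact: f_neq0.
set X := f (s0 ^+ i.+1)%g (s0 ^+ i.+1)^-1%g in eq1 eq2.
move: (f (s0 ^+ i.+1)%g h) u2 eq1 => U2 u2 eq1.
move: (ga (s0 ^+ i.+1)%g (f h s^-1%g)) u1 eq1 => U1 u1 eq1.
move: (f s0 (s0 ^+ i)%g) u3 eq2 => U3 u3 eq2.
have := ga_unit s0 (f (s0 ^+ i) (s0 ^+ i.+1)^-1)%g; rewrite u4.
move: (ga s0 _) eq2 => U4 eq2 u4'.
have SU U : unit_of S U -> U \in S by apply: unit_val.
have SV U : unit_of S U -> U^-1 \in S by apply: unit_valV.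
(* The cofactors collected along [eq2], [eq1], [ess] and a = a' q, so that q = b P q. *)
set P := U4^-1 * U3 * U1^-1 * U2 * ga s (f s^-1 (t * s))%g * a'.
have SP : P \in S by rewrite ?(valM valS) //; solve [exact: SU | exact: SV].
have bP : b * P = 1.
  apply: (mulIf q0); rewrite mul1r.
  have U10 := unit_neq0 u1; have U40 := unit_neq0 u4'.
  rewrite -[RHS](mulKf U40) eq2 -[X](mulKf U10) eq1 -ess ea /P.
  by ring.
have := unit1 valS; rewrite -bP => /(unitMl valS (nonunit_val jb) SP).
by rewrite (negPf (nonunit_not_unit jb)).
Qed.

(** * The crossed product algebra and its radical *)

Section Algebra.
Local Notation D := {ffun gT -> L^o}.
Local Notation tr := (fun k s : gT => (k * s)%g).
Local Notation op := (@Xop gT tr id).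
Implicit Types (a b v w y : D).

Let tr1 (k : gT) : tr k 1%g = k. Proof. exact: mulg1. Qed.
Let trM (k s t : gT) : tr (tr k s) t = tr k (s * t)%g. Proof. exact: esym (mulgA k s t). Qed.
Let prM (k s : gT) : id (tr k s) = (id k * s)%g. Proof. by []. Qed.

Definition cpm a b : D :=
  [ffun r => \sum_s a s * ga s (b (r * s^-1)%g) * f s (r * s^-1)%g].
Definition sym (s : gT) : D := [ffun t => if t == s then 1 else 0].

Lemma cpmE a b : cpm a b = \sum_s a s *: op s b.
Proof.
apply/ffunP => r; rewrite ffunE sum_ffunE; apply: eq_bigr => s _.
by rewrite scalE XopE mulrA.
Qed.
(** On one copy of the algebra the maps commuting with left multiplication are right
    multiplications; the results on [extend] thus apply to products. *)
Lemma extendE z v : @extend gT tr id z v = cpm v (z 1%g).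
Proof. by rewrite cpmE; apply: eq_bigr => s _; rewrite /base mulgV. Qed.
Lemma symE s : sym s = @delta gT s.
Proof. by apply/ffunP => t; rewrite !ffunE; case: eqP. Qed.
Lemma op_sym s : op s (sym 1%g) = sym s.
Proof. by rewrite !symE [RHS](delta_base id tr1 trM) /base mulgV. Qed.
Lemma cpm_linearl y : linear (fun v => cpm v y).
Proof.
move=> c v w; have := extend_linear tr id (fun=> y) c v w.
by rewrite !extendE.
Qed.
Lemma cpmDl : left_distributive cpm +%R.
Proof. by move=> v w y; have := cpm_linearl y 1 v w; rewrite !scale1r. Qed.
Lemma cpm0l y : cpm 0 y = 0.
Proof. by apply: (addIr (cpm 0 y)); rewrite -cpmDl !add0r. Qed.
Lemma cpmZl c v y : cpm (c *: v) y = c *: cpm v y.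
Proof. by have := cpm_linearl y c v 0; rewrite cpm0l !addr0. Qed.
Lemma cpmDr : right_distributive cpm +%R.
Proof.
move=> v w y; rewrite !cpmE -big_split; apply: eq_bigr => s _ /=.
by rewrite XopD scalerDr.
Qed.
Lemma cpm0r y : cpm y 0 = 0.
Proof. by apply: (addIr (cpm y 0)); rewrite -cpmDr !add0r. Qed.
Lemma cpmNr v w : cpm v (- w) = - cpm v w.
Proof. by apply: (addrI (cpm v w)); rewrite -cpmDr !subrr cpm0r. Qed.
Lemma cpmBr v w y : cpm v (w - y) = cpm v w - cpm v y.
Proof. by rewrite cpmDr cpmNr. Qed.
Lemma cpmBl v w y : cpm (v - w) y = cpm v y - cpm w y.
Proof. by rewrite cpmDl -scaleN1r cpmZl scaleN1r. Qed.
Lemma cpm_suml (I : Type) (r : seq I) (P : pred I) (F : I -> D) y :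
  cpm (\sum_(i <- r | P i) F i) y = \sum_(i <- r | P i) cpm (F i) y.
Proof. by apply: (big_morph (cpm^~ y)); [move=> v w; exact: cpmDl|exact: cpm0l]. Qed.
Lemma op_cpm s v y : op s (cpm v y) = cpm (op s v) y.
Proof. by have := Xop_extend tr1 trM prM (fun=> y) s v; rewrite !extendE. Qed.
Lemma cpmA : associative cpm.
Proof.
move=> v w y; rewrite [cpm v w]cpmE cpm_suml cpmE; apply: eq_bigr => s _.
by rewrite cpmZl op_cpm.
Qed.
Lemma cpm1l : left_id (sym 1%g) cpm.
Proof.
move=> y; rewrite cpmE (bigD1 1%g) //= big1 => [|s /negPf ne].
  by rewrite ffunE eqxx scale1r addr0; apply: Xop1.
by rewrite ffunE ne scale0r.
Qed.
Lemma cpm1r : right_id (sym 1%g) cpm.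
Proof.
move=> y; rewrite cpmE [RHS]delta_sum; apply: eq_bigr => s _.
by rewrite op_sym symE.
Qed.
Lemma cpm_sym s y : cpm (sym s) y = op s y.
Proof. by rewrite -op_sym -op_cpm cpm1l. Qed.
Lemma lattice_cpm v y : lattice S v -> lattice S y -> lattice S (cpm v y).
Proof.
move=> Ev Ey; have := @extend_lattice gT tr id (fun=> y) v (fun=> Ey) Ev.
by rewrite extendE.
Qed.
Lemma lattice_sym s : lattice S (sym s).
Proof. by rewrite symE; apply: lattice_delta. Qed.

Let left_inv := left_inv_jacobson cpmA cpmDl cpmDr cpm1l cpm1r
  (lattice_sym 1%g) (@latticeB L S gT valS) lattice_cpm.

Lemma one_sub_left_inv y N : lattice S y ->
  (forall v, lattice S v -> forall k, nonunit S (iter N (cpm^~ y) v k : L)) ->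
  exists2 a, lattice S a & cpm a (sym 1%g - y) = sym 1%g.
Proof.
move=> Ey hN; have [v Ev|Th [ThE Th1 _]] :=
  @nakayama L S gT valS (cpm^~ y) N (cpm_linearl y) _ hN; first exact: lattice_cpm.
exists (Th (sym 1%g)); first by apply: ThE; apply: lattice_sym.
by rewrite cpmBr cpm1r Th1.
Qed.

Lemma nonunit_jacobson c : nonunit S c -> jacobson cpm (lattice S (X := gT)) (c *: sym 1%g).
Proof.
move=> jc; have Ec : lattice S (c *: sym 1%g).
  by apply: latticeZ; [|exact: nonunit_val|exact: lattice_sym].
apply: left_inv => // b Eb; apply: (@one_sub_left_inv _ 1) => [|v Ev k /=].
  exact: lattice_cpm.
rewrite cpmA; have : lattice S (cpm v b) by apply: lattice_cpm.
move: (cpm v b) => w Ew; rewrite ffunE; apply: nonunit_sum => // s _.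
apply: nonunitMr => //; apply: nonunitMl => //; rewrite ga_nonunit scalE.
by apply: nonunitMr => //; apply: lattice_sym.
Qed.

Section Uniformizer.
Variable s0 : gT.
Hypothesis uni : uniformizing s0.
Local Notation rad := (@radical_lattice gT id).

Lemma uniformizer_notin : s0 \notin H.
Proof.
by apply/negP; rewrite inE => u; have := uni 1%g; rewrite group1 mul1g => -[/nonunit_not_unit/negP].
Qed.

(** This gives A x_s0 inside x_s0 A, making the latter two-sided. If x_s x_s0 falls over H and f(s,
    s0) were a unit, the cocycle identity would make f(s0, s0^-1) a unit. *)
Lemma rad_sym v : lattice S v -> rad (cpm v (sym s0)).
Proof.
move=> Ev; rewrite cpmE; apply: radical_lattice_sum => s _.
apply: radical_latticeZ => //; rewrite -op_sym (XopM trM prM); split.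
  by apply: latticeZ => //; apply: Xop_lattice => //; apply: lattice_sym.
move=> r rH; rewrite op_sym scalE ffunE; case: eqP => [er|_]; last by rewrite mulr0 nonunit0.
rewrite mulr1 /nonunit fS; apply: contra uniformizer_notin => u.
have := fco s s0 s0^-1%g; rewrite mulVg f1r mulr1 inE => e.
by rewrite -(ga_unit s) e unitM // f_unitl // -er.
Qed.

Lemma rad_cpml v y : lattice S v -> rad y -> rad (cpm v y).
Proof.
move=> Ev /(radical_latticeP tr1 trM prM uni)[w Ew ->]; rewrite -cpm_sym cpmA.
have := radical_lattice_extend tr1 trM prM uni (fun=> Ew) (rad_sym Ev).
by rewrite extendE.
Qed.
Lemma rad_cpmr v y : lattice S y -> rad v -> rad (cpm v y).
Proof.
move=> Ey rv; have := radical_lattice_extend tr1 trM prM uni (fun=> Ey) rv.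
by rewrite extendE.
Qed.

(** Right multiplication by b y, iterated N times, lands in x_s0^N A, hence in J A when N is the
    order of s0; Nakayama then inverts 1 - b y. *)
Lemma rad_jacobson y : rad y -> jacobson cpm (lattice S (X := gT)) y.
Proof.
move=> ry; apply: left_inv => [|b Eb]; first by case: ry.
have rby := rad_cpml Eb ry; have Eby : lattice S (cpm b y) by case: rby.
apply: (@one_sub_left_inv _ #[s0]%g) => // v Ev k.
have [w Ew ->] : exists2 w, lattice S w &
    iter #[s0]%g (cpm^~ (cpm b y)) v = iter #[s0]%g (op s0) w.
  elim: #[s0]%g => [|n [w Ew IH]]; first by exists v.
  have /(radical_latticeP tr1 trM prM uni)[w' Ew' e'] := rad_cpml Ew rby.
  exists w' => //; rewrite iterS IH [RHS]iterSr -e'.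
  by elim: n {IH} => //= n <-; rewrite op_cpm.
exact: iter_Xop.
Qed.

Variable c : L.
Hypothesis c_trace : \sum_(h in H) ga h c = 1.
Hypothesis cS : c \in S.

(** Semisimplicity of A / x_s0 A in explicit form: [radical_splitting] for the left ideal Z = A y +
    x_s0 A gives e in Z with v = v e modulo x_s0 A for v in Z. Write e = b y + q; as 1 - b y has a
    left inverse a, e = a (e - e e + q e) lies in x_s0 A, and so does y. *)
Lemma jacobson_rad y : jacobson cpm (lattice S (X := gT)) y -> rad y.
Proof.
move=> jy; have Ey : lattice S y by case: jy.
pose Z v := exists a q, [/\ lattice S a, rad q & v = cpm a y + q].
have rad_op s q : rad q -> rad (op s q).
  by move=> rq; rewrite -cpm_sym; apply: rad_cpml => //; apply: lattice_sym.
have rad0 : rad 0 by apply: radical_lattice0.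
have [|||s z [a [q [Ea rq ->]]]|z Zz zQ] := @radical_splitting gT tr id tr1 trM prM
  s0 uni c c_trace cS Z.
- by move=> z [a [q [Ea [Eq _] ->]]]; apply: latticeD => //; apply: lattice_cpm.
- by exists 0, 0; split; rewrite ?cpm0l ?addr0 //; apply: lattice0.
- move=> d z w Sd [a [q [Ea rq ->]]] [b [p [Eb rp ->]]].
  exists (d *: a + b), (d *: q + p); split.
  + by apply: latticeD => //; apply: latticeZ.
  + by apply: radical_latticeD => //; apply: radical_latticeZ.
  + by rewrite cpm_linearl scalerDr addrACA.
- exists (op s a), (op s q); split; [exact: Xop_lattice|exact: rad_op|].
  by rewrite XopD op_cpm.
set e := z 1%g; have zE v : Z v -> rad (v - cpm v e) by move/zQ; rewrite extendE.
have [b [q [Eb rq eb]]] := Zz 1%g; rewrite -/e in eb.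
have Ee : lattice S e by rewrite eb; apply: latticeD => //; [exact: lattice_cpm|case: rq].
have [a Ea ea] := jacobson_left_inv cpmA cpmDl cpm1l cpm1r
  (lattice_sym 1%g) (@latticeB L S gT valS) lattice_cpm jy Eb.
have re : rad e.
  have -> : e = cpm a ((e - cpm e e) + cpm q e).
    rewrite -[LHS]cpm1l -ea -cpmA cpmBl cpm1l -addrA; congr (cpm a (e + _)).
    have -> : cpm e e = cpm (cpm b y) e + cpm q e by rewrite -cpmDl -eb.
    by rewrite opprD subrK.
  apply: rad_cpml => //; apply: radical_latticeD => //; last exact: rad_cpmr.
  exact/zE/Zz.
have Zy : Z y by exists (sym 1%g), 0; split; rewrite ?cpm1l ?addr0 //; apply: lattice_sym.
have := radical_latticeD (zE y Zy) (rad_cpml Ey re).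
by rewrite subrK.
Qed.

Lemma jacobson_uniformizing y : jacobson cpm (lattice S (X := gT)) y <->
  exists2 a, lattice S a & y = cpm (sym s0) a.
Proof.
split=> [/jacobson_rad/(radical_latticeP tr1 trM prM uni)[w Ew ->]|[a Ea ->]].
  by exists w; rewrite ?cpm_sym.
apply: rad_jacobson; apply: rad_cpmr => //.
by rewrite -[sym s0]cpm1l; apply: rad_sym; apply: lattice_sym.
Qed.

End Uniformizer.

(** * Projectivity of finitely generated left ideals *)

Section LeftSemihereditary.
Variable c : L.
Hypothesis c_trace : \sum_(h in H) ga h c = 1.
Hypothesis cS : c \in S.
Hypothesis unit_or_uni : (forall s, s \in H) \/ exists s0, uniformizing s0.

Section FreeModule.
Variable n : nat.
Local Notation X := ('I_n * gT)%type.
Local Notation M := {ffun X -> L^o}.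
Local Notation trn := (fun (x : X) s => (x.1, (x.2 * s)%g)).
Local Notation opn := (@Xop X trn snd).

Let trn1 x : trn x 1%g = x. Proof. by case: x => i k; rewrite mulg1. Qed.
Let trnM x s t : trn (trn x s) t = trn x (s * t)%g.
Proof. by rewrite /= mulgA. Qed.
Let prnM x s : (trn x s).2 = (x.2 * s)%g. Proof. by []. Qed.

(** A^n is stored as functions on 'I_n * gT, so that the operator results apply with [pr] the second
    projection. *)
Definition mrow (i : 'I_n) (v : M) : D := [ffun k => v (i, k)].
Definition pack (w : 'I_n -> D) : M := [ffun x => w x.1 x.2].

Lemma mrow_pack (w : 'I_n -> D) i : mrow i (pack w) = w i.
Proof. by apply/ffunP => k; rewrite !ffunE. Qed.
Lemma mrow_linear i : linear (mrow i).
Proof. by move=> a v v'; apply/ffunP => k; rewrite !ffunE. Qed.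
Lemma mrowD i (v v' : M) : mrow i (v + v') = mrow i v + mrow i v'.
Proof. by apply/ffunP => k; rewrite !ffunE. Qed.
Lemma mrowB i (v v' : M) : mrow i (v - v') = mrow i v - mrow i v'.
Proof. by apply/ffunP => k; rewrite !ffunE. Qed.
Lemma mrow_lattice i (v : M) : lattice S v -> lattice S (mrow i v).
Proof. by move=> Ev k; rewrite ffunE; apply: Ev. Qed.
Lemma pack_lattice (w : 'I_n -> D) : (forall i, lattice S (w i)) -> lattice S (pack w).
Proof. by move=> Ew x; rewrite ffunE; apply: Ew. Qed.
Lemma mrow_op i s (v : M) : mrow i (opn s v) = op s (mrow i v).
Proof. by apply/ffunP => k; rewrite !ffunE. Qed.

Definition smul (a : D) (v : M) : M := \sum_s a s *: opn s v.

Lemma mrow_smul i a (v : M) : mrow i (smul a v) = cpm a (mrow i v).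
Proof.
pose R : {linear M -> D} := HB.pack (mrow i) (GRing.isLinear.Build _ _ _ _ (mrow i) (mrow_linear i)).
rewrite -[mrow i]/(R : _ -> _) linear_sum cpmE; apply: eq_bigr => s _.
by rewrite linearZZ -mrow_op.
Qed.
Lemma smul_lattice a (v : M) : lattice S a -> lattice S v -> lattice S (smul a v).
Proof.
move=> Ea Ev; apply: lattice_sum => // s _; apply: latticeZ => //.
exact: Xop_lattice.
Qed.

Variable g : 'I_n -> D.
Definition lincomb (v : M) : D := \sum_i cpm (mrow i v) (g i).

Lemma lincomb_linear : linear lincomb.
Proof.
move=> a v w; rewrite /lincomb scaler_sumr -big_split; apply: eq_bigr => i _ /=.
by rewrite mrow_linear cpm_linearl.
Qed.
Lemma lincomb_op s (v : M) : lincomb (opn s v) = op s (lincomb v).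
Proof. by rewrite Xop_sum; apply: eq_bigr => i _; rewrite mrow_op op_cpm. Qed.
Lemma lincomb_smul a (v : M) : lincomb (smul a v) = cpm a (lincomb v).
Proof.
rewrite /lincomb; apply/esym.
rewrite (big_morph (cpm a) (id1 := 0) (op1 := +%R)); last exact: cpm0r; last exact: cpmDr.
by apply: eq_bigr => i _; rewrite mrow_smul cpmA.
Qed.
Lemma lincomb_pack (w : 'I_n -> D) : lincomb (pack w) = \sum_i cpm (w i) (g i).
Proof. by apply: eq_bigr => i _; rewrite mrow_pack. Qed.

Lemma lincomb_retraction : exists e : M -> M,
  @equivariant_retraction X trn snd (fun v : M => lincomb v = 0) e.
Proof.
pose C : {linear M -> D} := HB.pack lincomb (GRing.isLinear.Build _ _ _ _ lincomb lincomb_linear).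
have W0 : lincomb 0 = 0 by rewrite -[lincomb]/(C : _ -> _) linear0.
have WD (a : L) (v w : M) : lincomb v = 0 -> lincomb w = 0 -> lincomb (a *: v + w) = 0.
  by move=> ev ew; rewrite lincomb_linear ev ew scaler0 addr0.
have WX s (v : M) : lincomb v = 0 -> lincomb (opn s v) = 0 by move=> ev; rewrite lincomb_op ev Xop0.
case: unit_or_uni => [hH|[s0 uni]].
  exact: (retraction_unit trn1 trnM prnM W0 WD WX c_trace cS hH).
exact: (retraction_uniformizing trn1 trnM prnM W0 WD WX c_trace cS uni).
Qed.
End FreeModule.

(** With e a retraction of A^n onto the kernel of A^n -> I, the section sends x to v - e v for any
    lift v of x. *)
Lemma fg_left_projective I : fg_left_ideal cpm (lattice S (X := gT)) I ->
  projective_left cpm (lattice S (X := gT)) I.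
Proof.
case=> lI [n [g [gI hI]]].
have [e [elin eX eE eW eI]] := lincomb_retraction g.
pose Q (v : {ffun 'I_n * gT -> L^o}) x := lattice S v /\ lincomb g v = x.
have hQ x : I x -> exists v : {ffun 'I_n * gT -> L^o}, Q v x.
  move=> /hI[a [Ea ->]]; exists (pack a); split; first exact: pack_lattice.
  by rewrite lincomb_pack.
pose sel x := if boolp.pselect (I x) is left Ix then sval (boolp.cid (hQ x Ix)) else 0.
have selP x : I x -> Q (sel x) x.
  by rewrite /sel; case: boolp.pselect => // Ix _; case: (boolp.cid _).
pose E := HB.pack_for {linear {ffun 'I_n * gT -> L^o} -> {ffun 'I_n * gT -> L^o}} e (GRing.isLinear.Build _ _ _ _ e elin).
pose C := HB.pack_for {linear {ffun 'I_n * gT -> L^o} -> D} (lincomb g) (GRing.isLinear.Build _ _ _ _ (lincomb g) (lincomb_linear g)).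
have e_smul a (v : {ffun 'I_n * gT -> L^o}) : e (smul a v) = smul a (e v).
  rewrite -[e]/(E : _ -> _) linear_sum; apply: eq_bigr => s _.
  by rewrite linearZZ; congr (_ *: _); apply: eX.
exists n, (fun w : 'I_n -> D => \sum_i cpm (w i) (g i)), (fun x i => mrow i (sel x - e (sel x))).
split.
- by move=> v Ev; apply/hI; exists v.
- move=> a v w Ea Ev Ew; rewrite -!lincomb_pack -lincomb_smul.
  rewrite -[lincomb g]/(C : _ -> _) -linearD; congr (C _).
  apply/ffunP => -[i k]; rewrite ffunE.
  have -> : (smul a (pack v) + pack w) (i, k) = mrow i (smul a (pack v)) k + pack w (i, k) :> L.
    by rewrite !ffunE.
  by rewrite mrow_smul mrow_pack !ffunE.
- move=> x /selP[Ex _] i; apply: mrow_lattice; apply: latticeB => //.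
  exact: eE.
- move=> a x y Ea Ix Iy; have [Ex cx] := selP x Ix; have [Ey cy] := selP y Iy.
  have Iz : I (cpm a x + y).
    case: lI => _ I0 IB IM; rewrite -[y]opprK; apply/IB; first exact: IM.
    by rewrite -sub0r; apply/IB.
  have [Ez cz] := selP _ Iz; apply: boolp.funext => i.
  set z := sel (cpm a x + y) in Ez cz *.
  (* [sel] is an arbitrary choice of lifts; two lifts of the same element differ by a kernel vector,
     which e fixes, and this makes the section linear. *)
  have : e (z - (smul a (sel x) + sel y)) = z - (smul a (sel x) + sel y).
    apply: eI.
      by apply: latticeB => //; apply: latticeD => //; apply: smul_lattice.
    rewrite -[lincomb g]/(C : _ -> _) linearB linearD -![C _]/(lincomb g _).
    by rewrite lincomb_smul cx cy cz subrr.
  rewrite -[e]/(E : _ -> _) linearB linearD => h.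
  have -> : z - E z = (smul a (sel x) + sel y) - (E (smul a (sel x)) + E (sel y)).
    have aux (V : zmodType) (p q r t : V) : q - t = p - r -> p - q = r - t.
      by move=> e1; rewrite -[p](subrK r) -e1 addrC !addrA addNr add0r addrC.
    exact: aux h.
  rewrite -![E _]/(e _) e_smul !(mrowB, mrowD, mrow_smul) cpmBr.
  by rewrite opprD addrACA.
- move=> x Ix; have [Ex cx] := selP x Ix.
  rewrite -[LHS]/(lincomb g (sel x - e (sel x))) -[lincomb g]/(C : _ -> _) linearB.
  by rewrite -[C (sel x)]/(lincomb g _) -[C _]/(lincomb g _) cx eW ?subr0.
Qed.
End LeftSemihereditary.

(* If f s t = a * b with a, b nonunits, then A x_s + A a is not projective:    *)
(* in the coefficient of x_1 of the dual-basis expansion of a, every term lies *)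
(* in a J(S).                                                                  *)
Lemma projective_nosq :
  (forall I, fg_left_ideal cpm (lattice S (X := gT)) I ->
             projective_left cpm (lattice S (X := gT)) I) ->
  forall s t (a b : L), nonunit S a -> nonunit S b -> f s t <> a * b.
Proof.
move=> proj g t a b ja jb est.
have a0 : a != 0 by apply: contraTneq (f_neq0 g t); rewrite est => ->; rewrite mul0r eqxx.
have Sa := nonunit_val ja.
pose one := sym 1%g; pose aa := a *: one.
have Eone : lattice S one by apply: lattice_sym.
have Eaa : lattice S aa by apply: latticeZ.
have Eg : lattice S (sym g) by apply: lattice_sym.
have ED (v w : D) : lattice S v -> lattice S w -> lattice S (v + w) by apply: latticeD.
have EM (v w : D) : lattice S v -> lattice S w -> lattice S (cpm v w) by apply: lattice_cpm.
pose I y := exists c0 c1, [/\ lattice S c0, lattice S c1 & y = cpm c0 (sym g) + cpm c1 aa].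
have lI : left_ideal cpm (lattice S (X := gT)) I.
  split=> [y [c0 [c1 [E0 E1 ->]]]||y y' [c0 [c1 [E0 E1 ->]]] [d0 [d1 [F0 F1 ->]]]|d y Ed [c0 [c1 [E0 E1 ->]]]].
  - by apply: ED; apply: EM.
  - by exists 0, 0; split; rewrite ?cpm0l ?addr0 //; apply: lattice0.
  - exists (c0 - d0), (c1 - d1); split; [exact: latticeB|exact: latticeB|].
    by rewrite !cpmBl opprD addrACA.
  - by exists (cpm d c0), (cpm d c1); split; rewrite ?cpmDr ?cpmA //; apply: EM.
have Ig : I (sym g) by exists one, 0; split; rewrite ?cpm1l ?cpm0l ?addr0 //; apply: lattice0.
have Ia : I aa by exists 0, one; split; rewrite ?cpm1l ?cpm0l ?add0r //; apply: lattice0.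
have fgI : fg_left_ideal cpm (lattice S (X := gT)) I.
  split=> //; exists 2%N, (fun i => if i == ord0 then sym g else aa); split.
    by move=> i; case: ifP.
  move=> x; split=> [[c0 [c1 [E0 E1 ->]]]|[c [Ec ->]]].
    exists (fun i : 'I_2 => if i == ord0 then c0 else c1); split; first by move=> i; case: ifP.
    by rewrite big_ord_recl big_ord1.
  by exists (c ord0), (c (lift ord0 ord0)); split=> //; rewrite big_ord_recl big_ord1.
have [n [p [j [p1 p2 j1 j2 pj]]]] := proj I fgI.
have pE := free_linear_sum cpm0r cpm1r Eone (lattice0 valS (X := gT)) ED p2 cpm1l.
pose y k := p (fun i => if i == k then one else 0).
have Iy k : I (y k) by apply: p1 => i; case: ifP => _ //; apply: lattice0.
pose u k := j aa k; have Eu k : lattice S (u k) by exact: j1.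
have eaa : aa = \sum_k cpm (u k) (y k) by rewrite -(pE (u)) // pj.
(* Chosen so that f(g^-1, g) = z a; it is a nonunit because b is one and [ga g^-1 a / a] is a
   unit. *)
pose z := f g^-1%g (t * g)%g * (ga g^-1%g a / a) * ga g^-1%g b.
have zE : f g^-1%g g = z * a.
  rewrite -(gaK g (f _ _)) f_inv -(f_dvd g t) est !rmorphM gaK /z.
  by field.
have jz : nonunit S z.
  rewrite /z; apply: nonunitMl => //; last by rewrite ga_nonunit.
  by apply: valM => //; apply: unit_val; apply: ga_div_unit.
have z0 : z != 0 by apply: contraTneq (f_neq0 g^-1%g g); rewrite zE => ->; rewrite mul0r eqxx.
(* The element z a of the ideal is both x_(g^-1) times x_g and z times [aa]; apply the linear [j] to
   both forms. *)
have xj k r : ga g^-1%g (j (sym g) k (r * g)%g) * f g^-1%g (r * g)%g = z * u k r :> L.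
  have eg : cpm (sym g^-1%g) (sym g) = cpm (z *: one) aa.
    rewrite cpm_sym -(op_sym g) (XopM trM prM) mulgV op_sym zE.
    by rewrite cpmZl cpm1l scalerA.
  have E1 : lattice S (sym g^-1%g) by apply: lattice_sym.
  have Ez : lattice S (z *: one) by apply: latticeZ => //; apply: nonunit_val.
  have I0 : I 0 by case: lI.
  have h1 := j2 _ _ 0 E1 Ig I0; have h2 := j2 _ _ 0 Ez Ia I0; rewrite -eg in h2.
  have : cpm (sym g^-1%g) (j (sym g) k) = cpm (z *: one) (j aa k).
    by apply: (addIr (j 0 k)); have := congr1 (fun F => F k) h1; rewrite h2.
  rewrite cpm_sym cpmZl cpm1l => /(congr1 (fun v : D => v r)).
  by rewrite XopE scalE invgK.
have ju k r : r \in H -> nonunit S (u k r : L).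
  move=> rH; have := fco g^-1%g g r; rewrite mulgV f1l mulr1 zE.
  have : unit_of S (ga g^-1%g (f g r)) by rewrite ga_unit f_unitr.
  move: (ga g^-1%g (f g r)) => w uw e.
  have : nonunit S (w * u k r).
    have -> : w * u k r = ga g^-1%g (j (sym g) k (r * g)%g) * a.
      by apply: (mulfI z0); rewrite mulrCA -xj mulrCA e; ring.
    by apply: nonunitMl => //; rewrite ga_val; apply: j1.
  by rewrite nonunit_unitMl.
have coef0 v r : cpm v (sym g) r = v (g^-1 * r)%g * f (g^-1 * r)%g g :> L.
  rewrite ffunE (bigD1 (g^-1 * r)%g) //= big1 => [|s ne].
    by rewrite ffunE invMg invgK mulKVg eqxx rmorph1 mulr1 addr0.
  rewrite ffunE; case: eqP => [e|_]; last by rewrite rmorph0 mulr0 mul0r.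
  by case/eqP: ne; rewrite -e invMg invgK mulgKV.
have coef1 v r : cpm v aa r = v r * ga r a :> L.
  rewrite ffunE (bigD1 r) //= big1 => [|s ne].
    by rewrite scalE ffunE mulgV eqxx f1r !mulr1 addr0.
  rewrite scalE ffunE; case: eqP => [e|_]; last by rewrite mulr0 rmorph0 mulr0 mul0r.
  by case/eqP: ne; rewrite -[LHS]mul1g -e mulgKV.
(* Write [y k] as c0 x_g + c1 a. After division by a, the first part carries the nonunit z; the
   second carries [u k s] if s is in H, and otherwise the nonunit f(s, s^-1). *)
have term k s : nonunit S (u k s * ga s (y k s^-1%g) * f s s^-1%g / a).
  have [c0 [c1 [E0 E1 ->]]] := Iy k.
  have -> : (cpm c0 (sym g) + cpm c1 aa) s^-1%g =
      c0 (g^-1 * s^-1)%g * f (g^-1 * s^-1)%g g + c1 s^-1%g * ga s^-1%g a :> L.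
    by rewrite -coef0 -coef1 ffunE.
  have := fco s (g^-1 * s^-1)%g g; rewrite mulKVg mulgKV zE => e.
  rewrite rmorphD !rmorphM gaKV.
  have -> : u k s * (ga s (c0 (g^-1 * s^-1)%g) * ga s (f (g^-1 * s^-1)%g g) +
      ga s (c1 s^-1%g) * a) * f s s^-1%g / a =
    u k s * ga s (c0 (g^-1 * s^-1)%g) * f s (g^-1 * s^-1)%g * z +
    u k s * ga s (c1 s^-1%g) * f s s^-1%g.
    have -> : forall A B C : L, A * (B * ga s (f (g^-1 * s^-1)%g g) + C * a) * f s s^-1%g / a =
        A * B * (ga s (f (g^-1 * s^-1)%g g) * f s s^-1%g) / a + A * C * f s s^-1%g.
      by move=> A B C; field.
    by rewrite e; field.
  have Su : u k s \in S by apply: Eu.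
  apply: nonunitD => //.
    by apply: nonunitMl => //; rewrite ?(valM valS) // ga_val.
  case: (boolP (s \in H)) => sH.
    by apply: nonunitMr => //; apply: nonunitMr; rewrite ?ga_val //; apply: ju.
  apply: nonunitMl; rewrite ?(valM valS) ?ga_val //.
  by rewrite inE in sH; rewrite /nonunit fS.
have : a = \sum_k \sum_s u k s * ga s (y k s^-1%g) * f s s^-1%g.
  have -> : a = aa 1%g :> L by rewrite scalE ffunE eqxx mulr1.
  rewrite {1}eaa sum_ffunE; apply: eq_bigr => k _; rewrite ffunE.
  by apply: eq_bigr => s _; rewrite mul1g.
move/(congr1 (fun x => x / a)); rewrite divff // mulr_suml => e.
have : nonunit S (1 : L).
  rewrite e; apply: nonunit_sum => // k _; rewrite mulr_suml.
  by apply: nonunit_sum.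
by rewrite nonunit1.
Qed.

End Algebra.
End Crossed.

(** * Elements of trace one *)

Section PolynomialsModulo.
Variables (L : fieldType) (S : {pred L}).
Hypothesis valS : valuation_ring S.
Implicit Types p q r : {poly L}.

Definition intp p := forall i, p`_i \in S.
Definition radp p := forall i, nonunit S p`_i.

Lemma radp_intp p : radp p -> intp p. Proof. by move=> h i; apply: nonunit_val. Qed.
Lemma intpD p q : intp p -> intp q -> intp (p + q).
Proof. by move=> hp hq i; rewrite coefD valD. Qed.
Lemma intpN p : intp p -> intp (- p).
Proof. by move=> hp i; rewrite coefN valN. Qed.
Lemma intpB p q : intp p -> intp q -> intp (p - q).
Proof. by move=> hp hq; apply: intpD => //; apply: intpN. Qed.
Lemma intpM p q : intp p -> intp q -> intp (p * q).
Proof. by move=> hp hq i; rewrite coefM val_sum // => j _; rewrite valM. Qed.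
Lemma intpC c : c \in S -> intp c%:P.
Proof. by move=> Sc i; rewrite coefC; case: eqP => _; rewrite ?val0. Qed.
Lemma intpX : intp 'X.
Proof. by move=> i; rewrite coefX; case: eqP => _; rewrite ?val0 ?val1. Qed.
Lemma intp1 : intp 1. Proof. by rewrite -polyC1; apply/intpC/val1. Qed.
Lemma intp0 : intp 0. Proof. by rewrite -polyC0; apply/intpC/val0. Qed.
Lemma intpXn p n : intp p -> intp (p ^+ n).
Proof. by move=> hp; elim: n => [|n IH]; rewrite ?exprS; [exact: intp1|exact: intpM]. Qed.
Lemma intp_horner p x : intp p -> x \in S -> p.[x] \in S.
Proof.
by move=> hp Sx; rewrite horner_coef val_sum // => i _; rewrite valM ?valX.
Qed.
Lemma radpD p q : radp p -> radp q -> radp (p + q).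
Proof. by move=> hp hq i; rewrite coefD nonunitD. Qed.
Lemma radpN p : radp p -> radp (- p).
Proof. by move=> hp i; rewrite coefN nonunit_opp. Qed.
Lemma radpB p q : radp p -> radp q -> radp (p - q).
Proof. by move=> hp hq; apply: radpD => //; apply: radpN. Qed.
Lemma radpMl p q : intp p -> radp q -> radp (p * q).
Proof. by move=> hp hq i; rewrite coefM nonunit_sum // => j _; rewrite nonunitMl. Qed.
Lemma radpMr p q : radp p -> intp q -> radp (p * q).
Proof. by move=> hp hq; rewrite mulrC; apply: radpMl. Qed.
Lemma radpC c : nonunit S c -> radp c%:P.
Proof. by move=> Sc i; rewrite coefC; case: eqP => _; rewrite ?nonunit0. Qed.
Lemma radp_horner p x : radp p -> x \in S -> nonunit S p.[x].
Proof.
move=> hp Sx; rewrite horner_coef nonunit_sum // => i _.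
by rewrite nonunitMr ?valX.
Qed.

Lemma horner_split p x : intp p -> x \in S ->
  exists2 p1, intp p1 & p = p.[x]%:P + ('X - x%:P) * p1.
Proof.
move=> + Sx; elim/poly_ind: p => [_|p c IH hp].
  by exists 0; [exact: intp0|rewrite horner0 mulr0 addr0].
have [i|p1 hp1 e] := IH.
  by have := hp i.+1; rewrite coefD coefMX coefC /= addr0.
exists (p.[x]%:P + p1 * 'X).
  apply: intpD; last by apply: intpM => //; apply: intpX.
  apply: intpC; apply: intp_horner => // i.
  by have := hp i.+1; rewrite coefD coefMX coefC /= addr0.
by rewrite {1}e hornerMXaddC polyCD polyCM; ring.
Qed.

(* By Taylor expansion p = p'(x) (X - x) + O((X - x)^2) modulo the radical, so  *)
(* X - x lies in (p, (X - x)^2), hence in (p, (X - x)^k) for all k.             *)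
Lemma separable_nilpotent p x k : intp p -> x \in S -> nonunit S p.[x] ->
  unit_of S p^`().[x] -> exists A B, [/\ intp A, intp B
    & radp ('X - x%:P - A * p - B * ('X - x%:P) ^+ k.+1)].
Proof.
move=> hp Sx px dpx; set D := 'X - x%:P.
have hD : intp D by apply: intpB; [exact: intpX|exact: intpC].
have [p1 hp1 e1] := horner_split hp Sx; rewrite -/D in e1.
have [p2 hp2 e2] := horner_split hp1 Sx; rewrite -/D in e2.
have eu : p1.[x] = p^`().[x].
  rewrite [in RHS]e1 derivD derivC add0r derivM derivB derivX derivC subr0 mul1r.
  by rewrite hornerD hornerM hornerXsubC subrr mul0r addr0.
set u := p^`().[x] in dpx eu.
have u0 := unit_neq0 dpx.
have ui : intp (u^-1)%:P by apply: intpC; apply: unit_valV.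
have eD : D = (u^-1)%:P * (p - p.[x]%:P - D * D * p2).
  have -> : p - p.[x]%:P - D * D * p2 = u%:P * D.
    by rewrite {1}e1 {1}e2 eu; ring.
  by rewrite mulrA -polyCM mulVf // mul1r.
elim: k => [|k [A [B [hA hB hR]]]].
  exists 0, 1; split; [exact: intp0|exact: intp1|].
  by rewrite mul0r subr0 mul1r expr1 subrr -polyC0; apply/radpC/nonunit0.
set R := (X in radp X) in hR.
exists ((u^-1)%:P - (u^-1)%:P * p2 * D * A), (- ((u^-1)%:P * p2 * B)); split.
- by apply: intpB => //; do !apply: intpM => //.
- by apply: intpN; do !apply: intpM => //.
have -> : D - ((u^-1)%:P - (u^-1)%:P * p2 * D * A) * p -
    - ((u^-1)%:P * p2 * B) * D ^+ k.+2 =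
  - ((u^-1)%:P * p.[x]%:P) - (u^-1)%:P * p2 * D * R.
  by rewrite {1}eD /R exprS; ring.
apply: radpB; first by apply: radpN; apply: radpMl => //; apply: radpC.
by apply: radpMl => //; do !apply: intpM => //.
Qed.

Lemma prod_XsubC_congr (I : eqType) (r : seq I) (F : I -> L) x : x \in S ->
  (forall i, i \in r -> nonunit S (F i - x)) ->
  radp (\prod_(i <- r) ('X - (F i)%:P) - ('X - x%:P) ^+ size r).
Proof.
move=> Sx; elim: r => [|i r IH] hr.
  by rewrite big_nil expr0 subrr -polyC0; apply/radpC/nonunit0.
have Fi : nonunit S (F i - x) by apply: hr; rewrite inE eqxx.
have SF : F i \in S by rewrite -[F i](subrK x) valD // nonunit_val.
have hD c : c \in S -> intp ('X - c%:P).
  by move=> Sc; apply: intpB; [exact: intpX|exact: intpC].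
rewrite big_cons /= exprS.
set P := \prod_(j <- r) _; set Q := _ ^+ _.
have -> : ('X - (F i)%:P) * P - ('X - x%:P) * Q =
    ('X - (F i)%:P) * (P - Q) - (F i - x)%:P * Q by rewrite polyCB; ring.
apply: radpB.
  by apply: radpMl; [exact: hD|apply: IH => j jr; apply: hr; rewrite inE jr orbT].
by apply: radpMr; [exact: radpC|apply: intpXn; apply: hD].
Qed.
End PolynomialsModulo.

(** * Residue fields, inertia and the trace *)

Section Residue.
Variables (F : fieldType) (L : splittingFieldType F) (V : {pred F}) (S : {pred L}).
Hypothesis valV : valuation_ring V.
Hypothesis valS : valuation_ring S.
Hypothesis galL : galois 1 {:L}.
Hypothesis intS : forall x, x \in S <-> integral_over V x.
Local Notation gT := (gal_of {:L}).
Local Notation inL := (in_alg L).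

Definition gal_morph (s : gT) : {rmorphism L -> L} := s.
Local Notation ga := gal_morph.

Lemma gal_morph1 a : ga 1%g a = a. Proof. exact: gal_id. Qed.
Lemma gal_morphM s t a : ga (s * t)%g a = ga t (ga s a).
Proof. by apply: galM; rewrite memvf. Qed.
Lemma gal_morph_alg s k : ga s (inL k) = inL k.
Proof. by rewrite /gal_morph /= linearZZ rmorph1. Qed.
Lemma gal_morph_val s a : a \in S -> ga s a \in S.
Proof.
move=> /intS[p [pm pV /rootP pr]]; apply/intS; exists p; split=> //.
apply/rootP; have := congr1 (ga s) pr; rewrite rmorph0 -horner_map -map_poly_comp.
by rewrite (eq_map_poly (gal_morph_alg s)).
Qed.

Lemma full_gal : 'Gal({:L} / 1%VS)%g = [set: gT].
Proof.
apply/setP => s; rewrite inE gal_kHom ?sub1v //; apply/kAHomP => a.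
by move=> /vlineP[k ->]; rewrite linearZZ rmorph1.
Qed.

Lemma fixed_alg a : (forall s, ga s a = a) -> exists k, a = inL k.
Proof.
move=> h; have /galois_fixedField e := galL.
have : a \in fixedField ('Gal({:L} / 1%VS))%g by apply/(fixedFieldP (memvf a)) => s _; apply: h.
by rewrite e => /vlineP[k ->]; exists k.
Qed.

(** V is integrally closed: if v is not in V, dividing a monic equation for v by its top power of v
    writes 1 as a sum of nonunits. *)
Lemma inL_val v : (inL v \in S) = (v \in V).
Proof.
apply/idP/idP => [/intS[p [pm pV pr]]|Vv]; last first.
  apply/intS; exists ('X - v%:P); split; first exact: monicXsubC.
    move=> i; rewrite coefB coefX coefC valB //.
      by case: eqP => _; rewrite ?val0 ?val1.
    by case: eqP => _; rewrite ?val0.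
  by rewrite rmorphB /= map_polyX map_polyC root_XsubC.
apply: contraT => nV; have v0 : v != 0 by apply: contraNneq nV => ->; apply: val0.
have jv := nonunit_inv valV nV.
move: pr; rewrite /root horner_map fmorph_eq0 => /eqP.
have := monic_neq0 pm; rewrite -size_poly_gt0.
move/monicP: pm; rewrite /lead_coef horner_coef; case: (size p) => // m e1 _.
rewrite big_ord_recr /= e1 mul1r => /eqP; rewrite addrC addr_eq0 => /eqP e2.
have : nonunit V (1 : F).
  rewrite -(divff (expf_neq0 m v0)) {1}e2 mulNr mulr_suml.
  apply: nonunit_opp => //; apply: nonunit_sum => // i _; rewrite -mulrA.
  apply: nonunitMl => //.
  have -> : v ^+ i / v ^+ m = v^-1 ^+ (m - i).-1 * v^-1.
    by rewrite -exprSr prednK ?subn_gt0 ?ltn_ord // exprVn expfB ?ltn_ord // invf_div.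
  by apply: nonunitMl => //; rewrite valX // nonunit_val.
by rewrite nonunit1.
Qed.

Lemma inL_nonunit v : nonunit S (inL v) = nonunit V v.
Proof. by rewrite /nonunit /unit_of inL_val fmorph_eq0 -fmorphV inL_val. Qed.

Variables (n : nat) (sb : 'I_n -> L).
Hypothesis sbS : forall i, sb i \in S.
Hypothesis sb_free : forall v : 'I_n -> F, (forall i, v i \in V) ->
  radical S (\sum_(i < n) inL (v i) * sb i) -> forall i, radical V (v i).
Hypothesis sb_span : forall x, x \in S -> exists v : 'I_n -> F, (forall i, v i \in V) /\
  radical S (x - \sum_(i < n) inL (v i) * sb i).

Lemma residue_functional : exists lam : L -> L, [/\
  forall y, y \in S -> exists2 v, v \in V & lam y = inL v,
  forall y z, y \in S -> z \in S -> nonunit S (lam (y + z) - (lam y + lam z)),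
  forall v y, v \in V -> y \in S -> nonunit S (lam (inL v * y) - inL v * lam y),
  forall y, nonunit S y -> nonunit S (lam y) & nonunit S (lam 1 - 1)].
Proof.
have freeJ (v : 'I_n -> F) i : (forall i, v i \in V) ->
    nonunit S (\sum_(i < n) inL (v i) * sb i) -> nonunit S (inL (v i)).
  by move=> hv /(radicalP valS) h; rewrite inL_nonunit; apply/(radicalP valV)/sb_free.
have ex y : exists v : 'I_n -> F, y \in S -> (forall i, v i \in V) /\
    nonunit S (y - \sum_(i < n) inL (v i) * sb i).
  case: (boolP (y \in S)) => [/sb_span[v [hv /(radicalP valS) h]]|_]; first by exists v.
  by exists (fun=> 0).
pose cf y := sval (boolp.cid (ex y)).
have cfV y i : y \in S -> cf y i \in V.
  by rewrite /cf; case: (boolp.cid _) => v h Sy /=; case: (h Sy).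
have cfJ y : y \in S -> nonunit S (y - \sum_(i < n) inL (cf y i) * sb i).
  by rewrite /cf; case: (boolp.cid _) => v h Sy /=; case: (h Sy).
have uniq y (v : 'I_n -> F) i : y \in S -> (forall i, v i \in V) ->
    nonunit S (y - \sum_(i < n) inL (v i) * sb i) ->
    nonunit S (inL (cf y i) - inL (v i)).
  move=> Sy hv h; rewrite -rmorphB; apply: (freeJ (fun i => cf y i - v i)) => [k|].
    by apply: valB => //; apply: cfV.
  rewrite (eq_bigr (fun i => inL (cf y i) * sb i - inL (v i) * sb i)); last first.
    by move=> k _; rewrite rmorphB mulrBl.
  have := nonunitB valS h (cfJ y Sy).
  by rewrite sumrB; congr (nonunit S _); ring.
have S1 := val1 valS.
have [i0 ui0] : exists i, unit_of S (inL (cf 1 i)).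
  case: (boolp.pselect (exists i, unit_of S (inL (cf 1 i)))) => // nex; exfalso.
  have := cfJ 1 S1; set T := \sum_(i < n) _ => h.
  have jT : nonunit S T.
    apply: nonunit_sum => // i _; apply: nonunitMr => //.
    rewrite /nonunit inL_val cfV //=; apply/negP => u; apply: nex; by exists i.
  by have := nonunitD valS h jT; rewrite subrK nonunit1.
set c := cf 1 i0 in ui0.
have cV : c^-1 \in V by rewrite -inL_val fmorphV unit_valV.
have c0 : c != 0 by rewrite -(fmorph_eq0 inL) (unit_neq0 ui0).
exists (fun y => inL (c^-1 * cf y i0)); split.
- by move=> y Sy; exists (c^-1 * cf y i0) => //; apply: valM => //; apply: cfV.
- move=> y z Sy Sz; rewrite -rmorphD -rmorphB -mulrDr -mulrBr rmorphM.
  apply: nonunitMl => //; first by rewrite inL_val.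
  rewrite rmorphB; apply: (uniq (y + z) (fun i => cf y i + cf z i)).
  + exact: valD.
  + by move=> i; apply: valD => //; apply: cfV.
  rewrite (eq_bigr (fun i => inL (cf y i) * sb i + inL (cf z i) * sb i)); last first.
    by move=> k _; rewrite rmorphD mulrDl.
  by rewrite big_split opprD addrACA nonunitD // cfJ.
- move=> v y Vv Sy; rewrite -rmorphM -rmorphB mulrCA -mulrBr rmorphM.
  have Svy : inL v * y \in S by rewrite valM // inL_val.
  apply: nonunitMl => //; first by rewrite inL_val.
  rewrite rmorphB; apply: (uniq (inL v * y) (fun i => v * cf y i)) => //.
    by move=> i; apply: valM => //; apply: cfV.
  rewrite (eq_bigr (fun i => inL v * (inL (cf y i) * sb i))); last first.
    by move=> k _; rewrite rmorphM mulrA.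
  by rewrite -mulr_sumr -mulrBr nonunitMl ?inL_val // cfJ.
- move=> y jy; rewrite rmorphM; apply: nonunitMl; rewrite ?inL_val //.
  have := uniq y (fun=> 0) i0 (nonunit_val jy) (fun=> val0 valV).
  rewrite big1 => [|i _]; last by rewrite rmorph0 mul0r.
  by rewrite subr0 rmorph0 subr0; apply.
- by rewrite mulVf // rmorph1 subrr nonunit0.
Qed.

Hypothesis sepS : residue_separable V S.

(** Modulo J, x is a simple root of P, and Q is a power of X - x, with P and Q over V. So X - x is
    their greatest common divisor and has coefficients in the residue field of V. Applying [lam] to
    the coefficients of X - x = A P + B Q and evaluating at x makes this explicit. *)
Lemma fixed_residue x : x \in S -> (forall s, nonunit S (ga s x - x)) ->
  exists2 v, v \in V & nonunit S (x - inL v).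
Proof.
move=> Sx fx; have [lam [lamV lamD lamM lamJ lam1]] := residue_functional.
have [p [pm pV /(radicalP valS) px [a [b [aV bV ab]]]]] := sepS Sx.
set P := map_poly inL p in px.
have iP : intp S P by move=> i; rewrite coef_map inL_val.
have dpx : unit_of S P^`().[x].
  have ia : intp S (map_poly inL a) by move=> i; rewrite coef_map inL_val.
  have ib : intp S (map_poly inL b) by move=> i; rewrite coef_map inL_val.
  have rab : radp S (map_poly inL (a * p + b * p^`() - 1)).
    by move=> i; rewrite coef_map inL_nonunit; apply/(radicalP valV).
  have := radp_horner valS rab Sx.
  rewrite rmorphB rmorphD !rmorphM rmorph1 /= -deriv_map -/P !hornerE => h.
  have jap : nonunit S ((map_poly inL a).[x] * P.[x]).
    by apply: nonunitMl => //; apply: intp_horner.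
  have h2 := nonunitB valS h jap.
  have SdP : P^`().[x] \in S.
    apply: intp_horner => // i; rewrite coef_deriv valMn //.
  apply: (@unitMr _ _ valS (map_poly inL b).[x]) => //; first exact: intp_horner.
  have -> : (map_poly inL b).[x] * P^`().[x] = 1 +
    ((map_poly inL a).[x] * P.[x] + (map_poly inL b).[x] * P^`().[x] - 1 -
      (map_poly inL a).[x] * P.[x]) by ring.
  by apply: unitD => //; apply: unit1.
(* The coefficients are Galois invariant and integral, hence in V. *)
pose Q := \prod_(s in [set: gT]) ('X - (ga s x)%:P).
set D := 'X - x%:P.
have iD : intp S D by apply: (intpB valS); [exact: intpX|exact: intpC].
have [N eN] : exists N, #|[set: gT]| = N.+1.
  by exists #|[set: gT]|.-1; rewrite prednK //; apply/card_gt0P; exists 1%g; rewrite inE.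
have QD : radp S (Q - D ^+ N.+1).
  by rewrite -eN cardE /Q -big_enum; apply: prod_XsubC_congr.
have iQ : intp S Q.
  have -> : Q = (Q - D ^+ N.+1) + D ^+ N.+1 by rewrite subrK.
  by apply: (intpD valS); [exact: radp_intp|exact: intpXn].
have Qfix k s : ga s Q`_k = Q`_k.
  rewrite -coef_map rmorph_prod; congr (_ : {poly L})`_k.
  rewrite /Q [RHS](reindex_inj (mulIg s)) /=.
  apply: eq_big => [t|t _]; first by rewrite !inE.
  by rewrite rmorphB /= map_polyX map_polyC gal_morphM.
have QV k : exists2 v, v \in V & Q`_k = inL v.
  have [v ev] := fixed_alg (Qfix k).
  by exists v => //; rewrite -inL_val -ev; apply: iQ.
have PV k : exists2 v, v \in V & P`_k = inL v by exists p`_k; rewrite ?coef_map.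
have [A [B [iA iB hR]]] := separable_nilpotent valS N iP Sx px dpx.
pose R := D - A * P - B * Q.
have rR : radp S R.
  have -> : R = (D - A * P - B * D ^+ N.+1) - B * (Q - D ^+ N.+1) by rewrite /R; ring.
  by apply: radpB => //; apply: radpMl.
pose lamp (C : {poly L}) := \poly_(i < size C) lam C`_i.
have lamS y : y \in S -> lam y \in S by move=> /lamV[v Vv ->]; rewrite inL_val.
have lampE C k : nonunit S ((lamp C)`_k - lam C`_k).
  rewrite coef_poly; case: ltnP => [_|h]; first by rewrite subrr nonunit0.
  by rewrite sub0r nonunit_opp // nth_default // lamJ // nonunit0.
have ilam C : intp S C -> intp S (lamp C).
  by move=> iC k; rewrite coef_poly; case: ifP => _; [exact: lamS|exact: val0].
have lam_sum m (G : nat -> L) : (forall k, G k \in S) ->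
    nonunit S (lam (\sum_(k < m) G k) - \sum_(k < m) lam (G k)).
  move=> SG; elim: m => [|m IH].
    by rewrite !big_ord0 subr0 lamJ // nonunit0.
  rewrite !big_ord_recr /=; set X := \sum_(k < m) G k in IH *.
  have SX : X \in S by apply: val_sum.
  by have := nonunitD valS (lamD X (G m) SX (SG m)) IH; congr (nonunit S _); ring.
have lampM C T k : intp S C -> intp S T -> (forall j, exists2 v, v \in V & T`_j = inL v) ->
    nonunit S (lam (C * T)`_k - (lamp C * T)`_k).
  move=> iC iT TV; rewrite !coefM.
  have SG j : C`_j * T`_(k - j) \in S by apply: valM.
  have h := lam_sum k.+1 _ SG.
  rewrite -[X in nonunit S X](subrKA (\sum_(j < k.+1) lam (C`_j * T`_(k - j)))).
  apply: nonunitD => //; rewrite -sumrB; apply: nonunit_sum => // j _.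
  have [v Vv ->] := TV (k - j)%N; have := lamM v C`_j Vv (iC j).
  rewrite [inL v * C`_j]mulrC => h1.
  have h2 : nonunit S (((lamp C)`_j - lam C`_j) * inL v).
    by apply: nonunitMr; rewrite ?inL_val.
  by have := nonunitB valS h1 h2; congr (nonunit S _); ring.
have main : radp S (lamp D - (lamp A * P + lamp B * Q)).
  move=> k; rewrite coefB coefD.
  have eD : D`_k = (A * P)`_k + ((B * Q)`_k + R`_k).
    by rewrite -!coefD; congr (_ : {poly L})`_k; rewrite /R; ring.
  have S1 : (A * P)`_k \in S by apply: intpM.
  have S2 : (B * Q)`_k \in S by apply: intpM.
  have S3 : R`_k \in S by apply: radp_intp.
  have h1 := lamD _ _ S1 (valD valS S2 S3); rewrite -eD in h1.
  have h2 := lamD _ _ S2 S3; have h3 := lamJ _ (rR k).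
  have h4 := lampM A P k iA iP PV; have h5 := lampM B Q k iB iQ QV.
  have h6 := lampE D k.
  have := nonunitD valS (nonunitD valS h6 h1) (nonunitD valS h2
            (nonunitD valS h3 (nonunitD valS h4 h5))).
  by congr (nonunit S _); ring.
have Qx : Q.[x] = 0.
  rewrite /Q horner_prod (bigD1 1%g) ?inE //= gal_morph1 hornerXsubC subrr.
  by rewrite mul0r.
have := radp_horner valS main Sx; rewrite hornerD hornerN hornerD !hornerM Qx mulr0 addr0 => h1.
have h2 : nonunit S ((lamp A).[x] * P.[x]).
  by apply: nonunitMl => //; apply: intp_horner => //; apply: ilam.
have eDx : (lamp D).[x] = lam (- x) + lam 1 * x.
  rewrite /lamp size_XsubC horner_poly big_ord_recl big_ord1 /= expr0 mulr1 expr1.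
  by rewrite !coefB !coefX !coefC /= sub0r subr0.
have [v Vv ev] := lamV (- x) (valN valS Sx).
exists (- v); first exact: valN.
have -> : x - inL (- v) = x + lam (- x) by rewrite ev rmorphN opprK.
have h3 : nonunit S ((lam 1 - 1) * x) by apply: nonunitMr.
have := nonunitB valS (nonunitD valS h1 h2) h3; rewrite eDx.
by congr (nonunit S _); ring.
Qed.
(** Artin's independence of characters modulo J: subtracting r0(z) times the relation at x from the
    relation at z x removes r0 and keeps r1, so the number of unit coefficients drops. *)
Lemma residue_independent (R : {set gT}) (y : gT -> L) :
  (forall r r', r \in R -> r' \in R -> r != r' ->
     exists2 z, z \in S & ~~ nonunit S (ga r z - ga r' z)) ->
  (forall r, y r \in S) ->
  (forall x, x \in S -> nonunit S (\sum_(r in R) y r * ga r x)) ->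
  forall r, r \in R -> nonunit S (y r).
Proof.
move=> sep; have [k] := ubnP #|[set r in R | ~~ nonunit S (y r)]|.
elim: k y => // k IH y hk yS hy r0 r0R; apply: contraT => u0.
have S1 := val1 valS.
case: (boolp.pselect (exists r1, [/\ r1 \in R, r1 != r0 & ~~ nonunit S (y r1)])).
  case=> r1 [r1R ne u1]; have [z Sz uz] := sep r1 r0 r1R r0R ne.
  pose y' r := y r * (ga r z - ga r0 z).
  have Sd r : ga r z - ga r0 z \in S by apply: valB => //; apply: gal_morph_val.
  have : nonunit S (y' r1).
    apply: IH => // [|r|x Sx].
    - apply: leq_trans (_ : #|[set r in R | ~~ nonunit S (y r)]| <= k)%N; last by rewrite -ltnS.
      apply: proper_card; apply/properP; split.
        apply/subsetP => r; rewrite !inE => /andP[-> h] /=.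
        by apply: contra h => h; apply: nonunitMr.
      by exists r0; rewrite !inE r0R //= /y' subrr mulr0 nonunit0.
    - exact: valM.
    have h1 := hy (z * x) (valM valS Sz Sx).
    have h2 : nonunit S (ga r0 z * \sum_(r in R) y r * ga r x).
      by apply: nonunitMl => //; [exact: gal_morph_val|exact: hy].
    have := nonunitB valS h1 h2; rewrite mulr_sumr -sumrB.
    congr (nonunit S _); apply: eq_bigr => r _.
    by rewrite rmorphM /y'; ring.
  rewrite nonunit_unitE // in u1; rewrite nonunit_unitE // in uz.
  by rewrite /y' unit_nonunitF // unitM.
move=> nex; have := hy 1 S1; rewrite (bigD1 r0) //= rmorph1 mulr1 => h.
have h2 : nonunit S (\sum_(i in R | i != r0) y i * ga i 1).
  apply: nonunit_sum => // r /andP[rR ne]; rewrite rmorph1 mulr1.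
  by apply: contraT => u; case: nex; exists r.
by have := nonunitB valS h h2; rewrite addrK (negPf u0).
Qed.

Definition inertia := [set g : gT | boolp.asbool (forall x, x \in S -> nonunit S (ga g x - x))].

Lemma inertiaP g : reflect (forall x, x \in S -> nonunit S (ga g x - x)) (g \in inertia).
Proof. by rewrite inE; apply: boolp.asboolP. Qed.

Lemma group_set_inertia : group_set inertia.
Proof.
apply/group_setP; split=> [|g h gI hI].
  by apply/inertiaP => x _; rewrite gal_morph1 subrr nonunit0.
apply/inertiaP => x Sx; rewrite gal_morphM.
rewrite -[X in nonunit S X](subrKA (ga g x)); apply: nonunitD => //.
  by move/inertiaP: hI; apply; apply: gal_morph_val.
by move/inertiaP: gI; apply.
Qed.
Canonical inertia_group := Group group_set_inertia.

Section Subgroup.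
Variable H : {group gT}.
Let I := (H :&: inertia)%G.
Definition inertia_repr g := repr (I :* g)%g.
Definition inertia_transversal := [set inertia_repr g | g in H].
Local Notation rho := inertia_repr.
Local Notation R := inertia_transversal.

Lemma rho_mem g : exists2 i, i \in I & rho g = (i * g)%g.
Proof. by apply/rcosetP; apply: mem_repr (rcoset_refl I g). Qed.
Lemma rho_eq g h : rho g = rho h -> (g * h^-1)%g \in I.
Proof.
have [i iI ->] := rho_mem g; have [j jI ->] := rho_mem h => e.
have -> : g = (i^-1 * j * h)%g by rewrite -mulgA -e mulKg.
by rewrite mulgK groupM ?groupV.
Qed.
Lemma rho_I i g : i \in I -> rho (i * g)%g = rho g.
Proof. by move=> iI; rewrite /rho rcosetM rcoset_id. Qed.
Lemma rhoK g : rho (rho g) = rho g.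
Proof. by have [i iI {1}->] := rho_mem g; apply: rho_I. Qed.
Lemma rho_H g : g \in H -> rho g \in H.
Proof. by move=> gH; have [i /setIP[iH _] ->] := rho_mem g; apply: groupM. Qed.
Lemma transversal_H r : r \in R -> r \in H.
Proof. by case/imsetP => g gH ->; apply: rho_H. Qed.
Lemma transversal_rho r : r \in R -> rho r = r.
Proof. by case/imsetP => g gH ->; apply: rhoK. Qed.
Lemma rho_transversal g : g \in H -> rho g \in R.
Proof. by move=> gH; apply/imsetP; exists g. Qed.

Lemma rho_congr g x : x \in S -> nonunit S (ga g x - ga (rho g) x).
Proof.
move=> Sx; have [i /setIP[_ /inertiaP iI] ->] := rho_mem g.
by rewrite gal_morphM -rmorphB -opprB rmorphN nonunit_opp // ga_nonunit ?iI //;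
  [exact: gal_morph1|exact: gal_morphM|exact: gal_morph_val].
Qed.

Lemma transversal_separated r r' : r \in R -> r' \in R -> r != r' ->
  exists2 z, z \in S & ~~ nonunit S (ga r z - ga r' z).
Proof.
move=> rR r'R ne.
case: (boolp.pselect (exists2 z, z \in S & ~~ nonunit S (ga r z - ga r' z))) => // nex.
case/eqP: ne; rewrite -(transversal_rho rR) -(transversal_rho r'R).
have iI : (r * r'^-1)%g \in I.
  apply/setIP; split; first by rewrite groupM ?groupV ?transversal_H.
  apply/inertiaP => x Sx; rewrite gal_morphM.
  rewrite -[X in _ - X]gal_morph1 -(mulgV r') gal_morphM -rmorphB ga_nonunit;
    [|exact: gal_morph1|exact: gal_morphM|exact: gal_morph_val].
  by apply: contraT => nj; case: nex; exists x.
by rewrite -(rho_I r' iI) mulgKV.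
Qed.

Lemma transversal_card g : g \in R -> #|[set h in H | rho h == g]| = #|I|.
Proof.
move=> gR; rewrite -(card_rcoset I g); apply: eq_card => h; rewrite !inE mem_rcoset.
apply/andP/idP => [[hH /eqP e]|gI].
  by apply: rho_eq; rewrite e transversal_rho.
have e : h = ((h * g^-1) * g)%g by rewrite mulgKV.
split; first by rewrite e; have [hH _] := setIP gI; apply: groupM => //; apply: transversal_H.
by rewrite e rho_I // transversal_rho.
Qed.

Lemma card_transversal : #|H| = (#|R| * #|I|)%N.
Proof.
rewrite -sum1_card (partition_big rho [in R]) /= => [|h hH]; last exact: rho_transversal.
rewrite -sum_nat_const; apply: eq_bigr => r rR.
by rewrite -(transversal_card rR) -sum1_card; apply: eq_bigl => h; rewrite inE.
Qed.

Lemma trace_transversal x : x \in S ->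
  nonunit S (\sum_(h in H) ga h x - (\sum_(r in R) ga r x) *+ #|I|).
Proof.
move=> Sx; rewrite (partition_big rho [in R]) /= => [|h hH]; last exact: rho_transversal.
rewrite -sumrMnl -sumrB; apply: nonunit_sum => // r rR.
rewrite -(transversal_card rR) -sumr_const.
rewrite [X in _ - X](eq_bigl (fun h => (h \in H) && (rho h == r))); last by move=> h; rewrite inE.
rewrite -sumrB; apply: nonunit_sum => // h /andP[_ /eqP <-].
exact: rho_congr.
Qed.

Lemma transversal_trace_unit : exists2 c, c \in S & ~~ nonunit S (\sum_(r in R) ga r c).
Proof.
case: (boolp.pselect (exists2 c, c \in S & ~~ nonunit S (\sum_(r in R) ga r c))) => // nex.
have hx x : x \in S -> nonunit S (\sum_(r in R) 1 * ga r x).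
  move=> Sx; rewrite (eq_bigr (fun r => ga r x)) => [|r _]; last by rewrite mul1r.
  by apply: contraT => nj; case: nex; exists x.
have := residue_independent transversal_separated (fun=> val1 valS) hx
  (rho_transversal (group1 H)).
by rewrite nonunit1.
Qed.
End Subgroup.

(** A kernel vector normalized to stay nonzero modulo J. *)
Lemma kernel_vector (m k : nat) (M : 'M[L]_(m, k)) : (k < m)%N ->
  exists v : 'I_m -> L, [/\ forall i, v i \in S, exists i, v i = 1
    & forall j, \sum_i v i * M i j = 0].
Proof.
move=> km; have : kermx M != 0.
  by rewrite -mxrank_eq0 mxrank_ker subn_eq0 -ltnNge; apply: leq_ltn_trans (rank_leq_col M) km.
case/rowV0Pn=> v /sub_kermxP vM v0.
pose w : {ffun 'I_m -> L^o} := [ffun i => v 0 i].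
have w0 : w != 0.
  apply: contraNneq v0 => e; apply/eqP/rowP => i; rewrite mxE.
  by have := congr1 (fun u : {ffun 'I_m -> L^o} => u i) e; rewrite !ffunE.
have [s [i [s0 Ew e1]]] := lattice_normalize valS w0.
exists (fun i => s * v 0 i); split.
- by move=> j; have := Ew j; rewrite scalE ffunE.
- by exists i; rewrite -e1 scalE ffunE.
- move=> j; have := congr1 (fun A : 'M[L]_(1, k) => s * A 0 j) vM.
  rewrite !mxE mulr0 mulr_sumr => e; rewrite -[RHS]e; apply: eq_bigr => l _.
  by rewrite mulrA.
Qed.

(** Right translation by s permutes the right cosets of the inertia group, and automorphisms in one
    coset agree modulo J. *)
Lemma transversal_fixed x s : x \in S ->
  nonunit S (ga s (\sum_(r in inertia_transversal [set: gT]%G) ga r x) -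
             \sum_(r in inertia_transversal [set: gT]%G) ga r x).
Proof.
move=> Sx; set R := inertia_transversal _; pose rho := inertia_repr [set: gT]%G.
have rinj : {in R &, injective (fun r => rho (r * s)%g)}.
  move=> r r' rR r'R /rho_eq; rewrite invMg mulgA mulgK => iI.
  by rewrite -(transversal_rho rR) -(transversal_rho r'R) -(rho_I r' iI) mulgKV.
have eR : [set rho (r * s)%g | r in R] = R.
  have sR : [set rho (r * s)%g | r in R] \subset R.
    by apply/subsetP => _ /imsetP[r _ ->]; apply: rho_transversal; rewrite inE.
  by apply/eqP; rewrite eqEcard sR (card_in_imset rinj) leqnn.
have e : \sum_(r in R) ga r x = \sum_(r in R) ga (rho (r * s)%g) x.
  by rewrite -[in LHS]eR (big_imset _ rinj).
rewrite [X in _ - X]e rmorph_sum -sumrB.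
apply: nonunit_sum => // r rR; rewrite -gal_morphM.
exact: rho_congr.
Qed.

Variable e : nat.
Hypothesis dimL : \dim {:L} = (e * n)%N.
Hypothesis tame : ~ radical V (e%:R : F).

(** Since |G| = e n, it suffices that G has n classes modulo inertia, n being the residue degree;
    both inequalities follow Artin. *)
Lemma card_inertia : #|inertia| = e.
Proof.
pose R := inertia_transversal [set: gT]%G.
have RP : (0 < #|R|)%N.
  by apply/card_gt0P; exists (inertia_repr [set: gT]%G 1%g); apply: rho_transversal; rewrite inE.
have cG : #|[set: gT]| = (e * n)%N.
  by rewrite -full_gal -galois_dim // dimv1 divn1.
have cR := card_transversal [set: gT]%G; rewrite -/R in cR.
rewrite /= setTI cG in cR.
suff nR : n = #|R|.
  by move/eqP: cR; rewrite nR mulnC eqn_pmul2l // => /eqP.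
have rS r : \sum_(j < #|R|) r (enum_val j) = \sum_(g in R) r g :> L.
  by rewrite [RHS]big_enum_val.
apply/eqP; rewrite eqn_leq; apply/andP; split; rewrite leqNgt; apply/negP => lt.
  (* More basis elements than classes. Twisting the relation c by automorphisms and summing over [R]
     gives coefficients [t i] fixed modulo J, so congruent to elements of V; [sb_free] makes them
     nonunits, yet with c i0 = 1 a suitable x makes [t i0] a unit. *)
  have [c [cS [i0 ci0] hc]] :=
    kernel_vector (\matrix_(i < n, j < #|R|) ga (enum_val j) (sb i)) lt.
  have hR r : r \in R -> \sum_i c i * ga r (sb i) = 0.
    move=> rR; have := hc (enum_rank_in rR r).
    by under eq_bigr do rewrite mxE enum_rankK_in //.
  have hG g : nonunit S (\sum_i c i * ga g (sb i)).
    have := hR _ (rho_transversal (in_setT g)) => h0.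
    rewrite -[X in nonunit S X]subr0 -[X in _ - X]h0 -sumrB; apply: nonunit_sum => // i _.
    by rewrite -mulrBr; apply: nonunitMl => //; apply: rho_congr.
  have hG' g x : x \in S -> nonunit S (\sum_i ga g (x * c i) * sb i).
    move=> Sx.
    have : nonunit S (ga g (x * \sum_i c i * ga g^-1%g (sb i))).
      rewrite ga_nonunit; [|exact: gal_morph1|exact: gal_morphM|exact: gal_morph_val].
      by apply: nonunitMl.
    rewrite mulr_sumr rmorph_sum; congr (nonunit S _); apply: eq_bigr => i _.
    by rewrite mulrA rmorphM -gal_morphM mulVg gal_morph1.
  have [x Sx] := transversal_trace_unit [set: gT]%G; rewrite -/R.
  pose t i := \sum_(r in R) ga r (x * c i).
  have St i : x * c i \in S by apply: valM.
  have tS i : t i \in S by apply: val_sum => // r _; apply: gal_morph_val.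
  have [v hv] : exists v : 'I_n -> F, forall i, v i \in V /\ nonunit S (t i - inL (v i)).
    have hv i : exists v, v \in V /\ nonunit S (t i - inL v).
      have [v Vv h] := fixed_residue (tS i) (fun s => transversal_fixed s (St i)).
      by exists v.
    by exists (fun i => sval (boolp.cid (hv i))) => i; case: (boolp.cid _).
  have ht : nonunit S (\sum_i t i * sb i).
    have -> : \sum_i t i * sb i = \sum_(r in R) \sum_i ga r (x * c i) * sb i.
      by rewrite exchange_big; apply: eq_bigr => i _; rewrite mulr_suml.
    by apply: nonunit_sum => // r _; apply: hG'.
  have hvs : radical S (\sum_(i < n) inL (v i) * sb i).
    apply/(radicalP valS).
    have h2 : nonunit S (\sum_i (t i - inL (v i)) * sb i).
      by apply: nonunit_sum => // i _; apply: nonunitMr => //; case: (hv i).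
    have := nonunitB valS ht h2; rewrite -sumrB; congr (nonunit S _).
    by apply: eq_bigr => i _; ring.
  have vV i : v i \in V by case: (hv i).
  have /(radicalP valV) := sb_free vV hvs i0; rewrite -inL_nonunit => j0.
  have [_ j1] := hv i0; have := nonunitD valS j1 j0; rewrite subrK /t ci0.
  by under eq_bigr do rewrite mulr1; move=> ->.
(* More classes than basis elements: a relation between automorphisms on the basis holds modulo J on
   all of S, against [residue_independent]. *)
have [y [yS [j0 yj0] hy]] :=
  kernel_vector (\matrix_(j < #|R|, i < n) ga (enum_val j) (sb i)) lt.
pose Y g := if boolp.pselect (g \in R) is left gR then y (enum_rank_in gR g) else 0.
have YE j : Y (enum_val j) = y j.
  rewrite /Y; case: boolp.pselect => [gR|]; last by case; apply: enum_valP.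
  by rewrite enum_valK_in.
have YS r : Y r \in S.
  by rewrite /Y; case: boolp.pselect => // ?; apply: val0.
have hx x : x \in S -> nonunit S (\sum_(r in R) Y r * ga r x).
  move=> Sx; have [v [vV /(radicalP valS) h]] := sb_span Sx.
  set x' := \sum_(i < n) _ in h.
  have e0 : \sum_(r in R) Y r * ga r x' = 0.
    rewrite -(rS (fun r => Y r * ga r x')).
    under eq_bigr => j _ do rewrite YE rmorph_sum mulr_sumr.
    rewrite exchange_big big1 // => i _.
    have := congr1 (fun z => inL (v i) * z) (hy i); rewrite mulr0 mulr_sumr => e0.
    rewrite -[RHS]e0; apply: eq_bigr => j _.
    by rewrite mxE rmorphM gal_morph_alg; ring.
  rewrite -[X in nonunit S X]subr0 -[X in _ - X]e0 -sumrB; apply: nonunit_sum => // r _.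
  rewrite -mulrBr -rmorphB; apply: nonunitMl => //.
  by rewrite ga_nonunit //; [exact: gal_morph1|exact: gal_morphM|exact: gal_morph_val].
have := residue_independent (@transversal_separated [set: gT]%G) YS hx (enum_valP j0).
by rewrite YE yj0 nonunit1.
Qed.

(** Modulo J the trace of c is the order of the inertia part of H times the sum over a transversal.
    That order divides e, a unit by tameness, and the sum is a unit for a suitable c; then divide c
    by its trace, which H fixes. *)
Lemma trace_one (H : {group gT}) : exists2 c, c \in S & \sum_(h in H) ga h c = 1.
Proof.
have [c Sc uc] := transversal_trace_unit H.
have h := trace_transversal H Sc.
set T := \sum_(r in _) _ in uc h; set t := \sum_(h in H) _ in h.
have ST : T \in S by apply: val_sum => // r _; apply: gal_morph_val.
have St : t \in S by apply: val_sum => // r _; apply: gal_morph_val.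
have ue : unit_of S (inL e%:R).
  rewrite -nonunit_unitE; last by rewrite inL_val valMn // val1.
  by rewrite inL_nonunit; apply/negP => /(radicalP valV).
have [k ek] : exists k, e = (#|(H :&: inertia)%G| * k)%N.
  have : (#|(H :&: inertia)%G| %| #|inertia|)%N by apply: cardSg; apply: subsetIr.
  by rewrite card_inertia => /dvdnP[k ->]; exists k; rewrite mulnC.
set m := #|(H :&: inertia)%G| in h ek.
have um : unit_of S (m%:R : L).
  apply: (@unitMl _ _ valS _ (k%:R)); rewrite ?valMn ?val1 //.
  by rewrite -natrM -ek; rewrite rmorph_nat in ue.
have ut : unit_of S t.
  have -> : t = T *+ m + (t - T *+ m) by rewrite addrC subrK.
  apply: unitD => //; rewrite -mulr_natr; apply: unitM => //.
  by rewrite -nonunit_unitE.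
have tfix h0 : h0 \in H -> ga h0 t = t.
  move=> h0H; rewrite rmorph_sum [RHS](reindex_inj (mulIg h0)) /=.
  by apply: eq_big => [g|g _]; rewrite ?groupMr // gal_morphM.
exists (c / t); first by apply: valM => //; apply: unit_valV.
have e1 : \sum_(h0 in H) ga h0 c / t = 1.
  by rewrite -mulr_suml -/t divff // (unit_neq0 ut).
rewrite -[RHS]e1; apply: eq_bigr => h0 h0H.
by rewrite rmorphM fmorphV tfix.
Qed.
End Residue.

(** * The equivalences *)

Section Semihereditary.
Variables (L : fieldType) (S : {pred L}) (gT : finGroupType).
Variable ga : gT -> {rmorphism L -> L}.
Hypothesis valS : valuation_ring S.
Hypothesis ga1 : forall a, ga 1%g a = a.
Hypothesis gaM : forall s t a, ga (s * t)%g a = ga t (ga s a).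
Hypothesis gaS : forall s a, a \in S -> ga s a \in S.
Hypothesis trace1 : forall H : {group gT},
  exists2 c, c \in S & \sum_(h in H) ga h c = 1.
Variable f : gT -> gT -> L.
Hypothesis fS : forall s t, f s t \in S.
Hypothesis f_neq0 : forall s t, f s t != 0.
Hypothesis f1l : forall s, f 1%g s = 1.
Hypothesis f1r : forall s, f s 1%g = 1.
Hypothesis fco : forall s t u,
  ga s (f t u) * f s (u * t)%g = f s t * f (t * s)%g u.
Hypothesis nosq : forall s t a b, nonunit S a -> nonunit S b -> f s t <> a * b.

Lemma nosq_left_projective (I : {ffun gT -> L^o} -> Prop) :
  fg_left_ideal (cpm ga f) (lattice S (X := gT)) I ->
  projective_left (cpm ga f) (lattice S (X := gT)) I.
Proof.
have gH : group_set (unit_part S f) by apply: group_set_unit_part fco.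
have [c cS c1] := trace1 (Group gH).
apply: (fg_left_projective valS ga1 gaM gaS fS f_neq0 f1l f1r fco c1 cS).
case: (unit_or_uniformizing valS ga1 gaM gaS fS f1l f1r fco nosq) => [h|[s0 [u _ _]]].
  by left.
by right; exists s0.
Qed.

(* The opposite ring of A_f is A_f' with f' = opp_cocycle; opp_map a lists the *)
(* right coefficients of a: a = sum_s x_(s^-1) (opp_map a s).                  *)
Definition opp_cocycle s t := ga (t * s)%g (f t^-1%g s^-1%g).
Definition opp_map (a : {ffun gT -> L^o}) : {ffun gT -> L^o} :=
  [ffun s => ga s (a s^-1%g : L)].

Lemma opp_cocycleP s t u : ga s (opp_cocycle t u) * opp_cocycle s (u * t)%g =
  opp_cocycle s t * opp_cocycle (t * s)%g u.
Proof.
rewrite /opp_cocycle -gaM !invMg mulgA.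
have -> : ga (t * s)%g (f t^-1%g s^-1%g) = ga (u * t * s)%g (ga u^-1%g (f t^-1%g s^-1%g)).
  by rewrite -gaM !mulgA mulVg mul1g.
by rewrite -!rmorphM -fco.
Qed.

Lemma opp_mapK : involutive opp_map.
Proof. by move=> a; apply/ffunP => s; rewrite !ffunE invgK -gaM mulVg ga1. Qed.
Lemma opp_mapB : {morph opp_map : x y / x - y}.
Proof. by move=> a b; apply/ffunP => s; rewrite !ffunE rmorphB. Qed.
Lemma opp_map_lattice a : lattice S a -> lattice S (opp_map a).
Proof. by move=> Ea s; rewrite ffunE gaS. Qed.
Lemma opp_mapM a b : opp_map (cpm ga f a b) = cpm ga opp_cocycle (opp_map b) (opp_map a).
Proof.
apply/ffunP => r; rewrite !ffunE rmorph_sum [RHS](reindex_inj (mulIg r)) /=.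
apply: eq_bigr => s _; have e : (r * (s * r)^-1 = s^-1)%g by rewrite invMg mulKVg.
by rewrite !ffunE /opp_cocycle e !rmorphM -!gaM mulKg invgK invMg; ring.
Qed.
End Semihereditary.

Section SemihereditaryTwoSided.
Variables (L : fieldType) (S : {pred L}) (gT : finGroupType).
Variable ga : gT -> {rmorphism L -> L}.
Hypothesis valS : valuation_ring S.
Hypothesis ga1 : forall a, ga 1%g a = a.
Hypothesis gaM : forall s t a, ga (s * t)%g a = ga t (ga s a).
Hypothesis gaS : forall s a, a \in S -> ga s a \in S.
Hypothesis trace1 : forall H : {group gT},
  exists2 c, c \in S & \sum_(h in H) ga h c = 1.
Variable f : gT -> gT -> L.
Hypothesis fS : forall s t, f s t \in S.
Hypothesis f_neq0 : forall s t, f s t != 0.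
Hypothesis f1l : forall s, f 1%g s = 1.
Hypothesis f1r : forall s, f s 1%g = 1.
Hypothesis fco : forall s t u,
  ga s (f t u) * f s (u * t)%g = f s t * f (t * s)%g u.
Hypothesis nosq : forall s t a b, nonunit S a -> nonunit S b -> f s t <> a * b.

(** The values of [opp_cocycle] are Galois images of values of f, so [nosq] passes to the opposite
    ring, and its left ideals give the right ideals here. *)
Lemma nosq_semihereditary : semihereditary (cpm ga f) (lattice S (X := gT)).
Proof.
split; first exact: nosq_left_projective.
refine (anti_projective (opp_mapK ga1 gaM) (opp_mapB ga) (@opp_map_lattice _ _ _ _ gaS)
  (opp_mapM gaM f) _).
apply: nosq_left_projective => //.
- by move=> s t; apply: gaS.
- by move=> s t; rewrite fmorph_eq0.
- by move=> s; rewrite /opp_cocycle invg1 f1r rmorph1.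
- by move=> s; rewrite /opp_cocycle invg1 f1l rmorph1.
- exact: opp_cocycleP.
- move=> s t a b ja jb e.
  have jg r y : nonunit S y -> nonunit S (ga r y) by rewrite ga_nonunit.
  apply: (@nosq t^-1%g s^-1%g _ _ (jg (t * s)^-1%g a ja) (jg (t * s)^-1%g b jb)).
  by rewrite -rmorphM -e /opp_cocycle -gaM mulgV ga1.
Qed.
End SemihereditaryTwoSided.

Theorem theorem3p2 (F : fieldType) (L : splittingFieldType F)
    (V : {pred F}) (S : {pred L}) (f : gal_of {:L} -> gal_of {:L} -> L) :
  valuation_ring V ->
  principal_ideal V (radical V) ->
  galois 1 {:L} ->
  tame_defectless V S ->
  (forall x, x \in S <-> integral_over V x) ->
  valuation_ring S ->
  (forall s t, s \in ('Gal({:L} / 1%VS))%g -> t \in ('Gal({:L} / 1%VS))%g ->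
     f s t \in S /\ f s t != 0) ->
  normalized_cocycle ('Gal({:L} / 1%VS))%g f ->
  let G := ('Gal({:L} / 1%VS))%g in
  let H := Hf G S f in
  let mul := cp_mul G f in
  let A := Af G S in
  [<-> semihereditary mul A;
       forall s t, s \in G -> t \in G -> ~ radical_sq S (f s t);
       [/\ group_set H, (H <| G)%g, cyclic (G / H)%g
         & H = G \/
           exists2 s, s \in G &
             [/\ (G / H)%g = <[coset H s]>%g,
                 forall i j, (i < #|(G / H)%g|)%N -> (j < #|(G / H)%g|)%N ->
                   Gr_le S f (s ^+ i)%g (s ^+ j)%g = (i <= j)%N
               & forall y, jacobson mul A y <->
                   exists2 a, A a & y = mul (xsym s) a]]].
Proof.
move=> valV _ galL [e [n [_ [sb [sbS sbf sbs]] dimL tame sep]]] intS valS.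
rewrite full_gal => f01 [f1 fco0] G H mul A.
pose gT := gal_of {:L}; pose ga := @gal_morph F L.
have ga1 := @gal_morph1 F L; have gaM := @gal_morphM F L.
have gaS := gal_morph_val intS.
have trace1 := trace_one valV valS galL intS sbS sbf sbs sep dimL tame.
have fS s t : f s t \in S by case: (f01 s t); rewrite ?inE.
have f_neq0 s t : f s t != 0 by case: (f01 s t); rewrite ?inE.
have f1l s : f 1%g s = 1 by case: (f1 s); rewrite ?inE.
have f1r s : f s 1%g = 1 by case: (f1 s); rewrite ?inE.
have fco s t u : ga s (f t u) * f s (u * t)%g = f s t * f (t * s)%g u.
  by apply: fco0; rewrite inE.
have eH : H = unit_part S f by apply/setP => s; rewrite !inE.
have emul : mul = cpm ga f.
  apply: boolp.funext => a; apply: boolp.funext => b; apply/ffunP => r.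
  by rewrite !ffunE; apply: eq_bigl => s; rewrite inE.
have eA : A = lattice S (X := gT).
  apply: boolp.funext => a; apply: boolp.propext; split=> [[h _] s|h].
    by apply: h; rewrite inE.
  by split=> s; rewrite inE // => _; apply: h.
have gH := group_set_unit_part valS ga1 gaM gaS fS f1l fco.
rewrite emul eA eH; clear emul eA eH H mul A.
pose nosq := forall s t a b, nonunit S a -> nonunit S b -> f s t <> a * b.
have sqP : nosq <-> forall s t, s \in G -> t \in G -> ~ radical_sq S (f s t).
  split=> [h s t _ _ /(radical_sqP valS)[/eqP|[a [b [ja jb]]]]|h s t a b ja jb est].
  - by rewrite (negPf (f_neq0 s t)).
  - exact: h.
  - by apply: (h s t); rewrite ?inE // est; apply: radical_sqM.
tfae.
- by case=> hl _; apply/sqP; apply: projective_nosq hl.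
- move/sqP => nq.
  case: (unit_or_uniformizing valS ga1 gaM gaS fS f1l f1r fco nq) => [hH|[s0 [uni gen chain]]].
    have -> : unit_part S f = G by apply/setP => s; rewrite hH inE.
    split; [exact: (groupP [set: gal_of {:L}]%G)|exact: (normal_refl [set: gal_of {:L}]%G)
           |by rewrite trivg_quotient cyclic1|by left].
  split=> //; first exact: unit_part_normal nq.
    by rewrite gen; apply: cycle_cyclic.
  right; exists s0; rewrite ?inE //; split=> //.
  have [c cS c1] := trace1 (Group gH).
  exact: (jacobson_uniformizing valS ga1 gaM gaS fS f_neq0 f1l f1r fco uni c1 cS).
case=> _ nH cyc hyp; suff nq : nosq by apply: nosq_semihereditary.
case: hyp => [HG s t a b ja jb est|[s0 _ [gen chain jac]]].
  have : unit_of S (f s t).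
    by apply: (f_unitl valS ga1 gaM gaS fS f1l fco); rewrite HG inE.
  by rewrite est => /(unitMl valS (nonunit_val ja) (nonunit_val jb)); rewrite (negPf (nonunit_not_unit ja)).
apply: (chain_nosq valS ga1 gaM gaS fS f_neq0 f1l f1r fco nH gen chain) => a ja.
(* For a nonunit a, the element a x_1 lies in J(A) = x_s0 A; comparing coefficients of x_1 shows
   that f(s0, s0^-1) divides a. *)
have /jac[w Ew ew] := nonunit_jacobson valS ga1 gaM gaS fS f1l f1r fco ja.
exists (ga s0 (w s0^-1%g)); first by apply: gaS; apply: Ew.
have := congr1 (fun v : {ffun gal_of {:L} -> L^o} => v 1%g : L) ew.
rewrite /= scalE -[xsym s0]/(sym L s0) (cpm_sym ga1 gaM f1l f1r fco) XopE mul1g.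
by rewrite ffunE eqxx mulr1.
Qed.
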